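(* Let $1<p<\infty$ and let $\varphi$ be a nonincreasing and nonnegative function on $\mathbb{R}_+=(0,+\infty)$ such that $\varphi(+\infty)=\lim_{x\to+\infty}\varphi(x)=0$. Then $$(p-1)\,\|H\varphi-\varphi\|_p \le \|\varphi\|_p\le (p-1)^{1/p}\,\|H\varphi-\varphi\|_p \qquad\text{if } 1<p\le 2,$$ and $$(p-1)^{1/p}\,\|H\varphi-\varphi\|_p \le \|\varphi\|_p\le (p-1)\,\|H\varphi-\varphi\|_p \qquad\text{if } 2\le p<\infty.$$ All constants in these inequalities are the best possible: for each $p$ in the respective range, the constant in the left-hand inequality cannot be replaced by any larger constant, and the constant in the right-hand inequality cannot be replaced by any smaller constant, if the inequality is to hold for all nonincreasing nonnegative functions $\varphi$ on $\mathbb{R}_+$ with $\varphi(+\infty)=0$.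
   Context: The Hardy operator $H$ is defined, for a nonnegative measurable function $\varphi$ on $\mathbb{R}_+=(0,+\infty)$ and $x>0$, by $$H\varphi(x)=\frac1x\int_0^x \varphi(t)\,dt\in[0,+\infty].$$ The function $\varphi$ takes finite values, and since it is nonincreasing, $H\varphi(x)-\varphi(x)\in[0,+\infty]$ for every $x>0$. For a nonnegative measurable function $g$ on $\mathbb{R}_+$, $\|g\|_p=\left(\int_0^\infty g(x)^p\,dx\right)^{1/p}\in[0,+\infty]$ denotes the $L^p(\mathbb{R}_+)$-norm with respect to Lebesgue measure. The norms are not assumed finite; the inequalities are understood in $[0,+\infty]$. *)

(* Defs.v *)
From mathcomp Require Import all_boot all_order all_algebra.
From mathcomp Require Import all_classical all_reals all_analysis.

Set Implicit Arguments.
Unset Strict Implicit.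
Unset Printing Implicit Defensive.

Import Order.TTheory GRing.Theory Num.Theory.
Import numFieldNormedType.Exports.

Local Open Scope classical_set_scope.
Local Open Scope ring_scope.

(* Functions on (0, +oo) are represented by functions on all of R; every
   definition below ignores the values taken outside `]0, +oo[. *)

Definition hardy (R : realType) (phi : R -> R) (x : R) : \bar R :=
  ((x^-1)%:E * \int[lebesgue_measure]_(t in `]0%R, x[) (phi t)%:E)%E.

(* phi x is finite, so this subtraction never has the form +oo - +oo *)
Definition hardy_sub (R : realType) (phi : R -> R) (x : R) : \bar R :=
  (hardy phi x - (phi x)%:E)%E.

(* Extension by 0 outside `]0, +oo[ gives the norm of L^p(0, +oo) for p > 0. *)
Definition halfline_Lnorm (R : realType) (p : R) (g : R -> \bar R) : \bar R :=
  ('N[lebesgue_measure]_p%:E[g \_ `]0%R, +oo[])%E.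

Definition nonincreasing_vanishing (R : realType) (phi : R -> R) : Prop :=
  [/\ {in `]0, +oo[ &, nonincreasing_fun phi},
      forall x, 0 < x -> 0 <= phi x
    & phi x @[x --> +oo] --> 0].

(* Main.v *)
Require Import Defs.
From mathcomp Require Import all_boot all_order all_algebra.
From mathcomp Require Import all_classical all_reals all_analysis.
From mathcomp Require Import measurable_realfun ring lra.

Set Implicit Arguments.
Unset Strict Implicit.
Unset Printing Implicit Defensive.

Import Order.TTheory GRing.Theory Num.Theory.
Import numFieldNormedType.Exports.

Local Open Scope classical_set_scope.
Local Open Scope ring_scope.

(** Write [h = H phi], [g = h - phi] and [G x = x * h x ^ p].  Then
    [G' = p h^(p-1) phi - (p-1) h^p], and for [p <= 2] one has the pointwise bounds
    [phi^p <= (p-1) g^p + G'] and [(p-1)^p g^p + l G' <= phi^p], where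
    [l = p ((p-1)/p)^(p-1) <= 1]; both are reversed for [p >= 2].  Integrating over
    [a, b] replaces [G'] by [G b - G a].  In the bounds for [g] the term [G a] is at
    most the integral of [phi^p] over [0, a], by Jensen.  In the bounds for [phi]
    one first replaces [phi] by [(phi - d)^+], which does not increase [g] and makes
    [G b] tend to [0].  The indicator of [0, 1] gives equality with constant
    [(p-1)^(1/p)]; the powers [x^(-a)], cut off at [1], with [a] tending to [1/p]
    approach the constant [p - 1]. *)

(** Since [phi] may jump, [G] need not be differentiable, and the formula for [G'] is only a guide.
    It is replaced by two-sided bounds on the increments of [G] in terms of the nonincreasing
    functions [p h^(p-1) phi] and [(p-1) h^p]; these determine [G b - G a] as a difference of
    integrals.

    Norms may be infinite, so terms of opposite sign stay on opposite sides, and only quantities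
    over []a, b]] with [0 < a], which are finite, are subtracted.

    The weight 1 gives equality whenever [u = 0] or [g = 0], the only cases met by the indicator.
    The other weight comes from [x^(-1/p)], for which [phi = (p-1) g] and [G] is constant: along
    this ray both sides agree, and tangency there fixes [l]. Jensen's inequality requires [l <= 1],
    and this weight serves in a bound for [g] only when [p <= 2], where that holds.

    In the bounds for [phi] nothing controls [G b] in advance. For a nonzero constant [phi] one has
    [g = 0] and the bounds fail, so the limit 0 at infinity has to enter there. *)

(** * Nonincreasing functions: measurability, integrals, increments *)

Definition nonincr (R : realType) (f : R -> R) :=
  forall x y : R, 0 < x -> x <= y -> f y <= f x.

(** The preimage of a half-line under a monotone function is an interval. It is formed inside []0,
    +oo[], where monotonicity holds, and then intersected with [D]. *)
Lemma measurable_nonincr (R : realType) (f : R -> R) (D : set R) :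
  nonincr f -> measurable D -> D `<=` `]0, +oo[ -> measurable_fun D f.
Proof.
move=> nf mD D0; rewrite -(opprK f); apply: measurableT_comp => //.
apply: (measurability (@RGenCInfty.G R)) => [|/= _ [_] [r] -> <-].
  exact: RGenCInfty.measurableE.
have mI : measurable (`]0, +oo[ `&` (-%R \o f) @^-1` `[r, +oo[ : set R).
  apply: is_interval_measurable => s t/=.
  rewrite !in_itv/= !andbT => -[s0 fs] [t0 ft] u /andP[su ut].
  have u0 := lt_le_trans s0 su.
  by rewrite !in_itv/= !andbT; split => //; rewrite (le_trans fs)// lerN2 nf.
rewrite (_ : _ `&` _ = D `&` (`]0, +oo[ `&` (-%R \o f) @^-1` `[r, +oo[)).
  exact: measurableI.
by rewrite setIA (setIidl D0).
Qed.

Lemma measurable_EFin_nonincr (R : realType) (f : R -> R) (D : set R) :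
  nonincr f -> measurable D -> D `<=` `]0, +oo[ ->
  measurable_fun D (EFin \o f).
Proof. by move=> nf mD D0; apply/measurable_EFinP; exact: measurable_nonincr. Qed.

Lemma subset_itvoc_pos (R : realType) (x y : R) :
  0 <= x -> `]x, y] `<=` (`]0, +oo[ : set R).
Proof.
move=> x0 t /=; rewrite !in_itv/= andbT => /andP[xt _].
exact: le_lt_trans x0 xt.
Qed.

Lemma integral_itvoc_cat (R : realType) (f : R -> \bar R) (x y z : R) :
  x <= y -> y <= z -> measurable_fun `]x, z] f ->
  (forall t, x < t -> (0 <= f t)%E) ->
  (\int[lebesgue_measure]_(t in `]x, z]) f t =
   \int[lebesgue_measure]_(t in `]x, y]) f t +
   \int[lebesgue_measure]_(t in `]y, z]) f t)%E.
Proof.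
move=> xy yz mf f0.
have e : `]x, z]%classic = `]x, y]%classic `|` `]y, z]%classic :> set R.
  by rewrite -itv_bndbnd_setU ?bnd_simp.
rewrite [in LHS]e ge0_integral_setU -?e//.
  by move=> t /=; rewrite in_itv/= => /andP[xt _]; exact: f0.
rewrite disj_set2E; apply/eqP/seteqP; split => // t /=.
rewrite !in_itv/= => -[/andP[_ ty] /andP[yt _]].
by move: (le_lt_trans ty yt); rewrite ltxx.
Qed.

Lemma integral_nonincr_bounds (R : realType) (f : R -> R) (x y : R) :
  nonincr f -> (forall t, 0 < t -> 0 <= f t) -> 0 < x -> x <= y ->
  exists2 r, (\int[lebesgue_measure]_(t in `]x, y]) (f t)%:E = r%:E)%E
    & (y - x) * f y <= r <= (y - x) * f x.
Proof.
move=> nf f0 x0 xy.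
have mxy : lebesgue_measure (`]x, y] : set R) = (y - x)%:E.
  rewrite lebesgue_measure_itv/= lte_fin; case: ltP => // yx.
  by rewrite (@le_anti _ _ x y) ?subrr// xy yx.
have mf : measurable_fun `]x, y] (EFin \o f).
  by apply: measurable_EFin_nonincr => //; apply/subset_itvoc_pos/ltW.
have y0 := lt_le_trans x0 xy.
set I := (\int[_]_(_ in _) _)%E.
have lo : (((y - x) * f y)%:E <= I)%E.
  rewrite mulrC EFinM -mxy -integral_cst//; apply: ge0_le_integral => //.
  - by move=> t _; rewrite lee_fin f0.
  - move=> t /=; rewrite in_itv/= lee_fin => /andP[xt ty].
    by apply: nf => //; exact: lt_trans xt.
have hi : (I <= ((y - x) * f x)%:E)%E.
  rewrite [in leRHS]mulrC EFinM -mxy -integral_cst//; apply: ge0_le_integral => //.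
  - move=> t /=; rewrite in_itv/= lee_fin => /andP[xt ty].
    by apply: f0; exact: lt_trans xt.
  - move=> t /=; rewrite in_itv/= lee_fin => /andP[xt ty].
    by apply: nf => //; exact: ltW.
have If : I \is a fin_num by rewrite fin_numE; case: I lo hi.
exists (fine I); first by rewrite fineK.
by rewrite -!lee_fin fineK// lo hi.
Qed.

(* Summing over [n + 1] equal steps telescopes the bound to
   [(b - a) (psi a - psi b) / (n + 1)]. *)
Lemma eq_of_small_increments (R : realType) (E psi : R -> R) (a b : R) :
  a <= b ->
  (forall x y, a <= x -> x <= y -> y <= b ->
     `|E y - E x| <= (y - x) * (psi x - psi y)) ->
  E a = E b.
Proof.
move=> ab H.
have key n : `|E b - E a| * n.+1%:R <= (b - a) * (psi a - psi b).
  pose d := (b - a) / n.+1%:R.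
  have n0 : 0 < n.+1%:R :> R by rewrite ltr0n.
  have d0 : 0 <= d by rewrite divr_ge0// ?subr_ge0// ltW.
  have dE : n.+1%:R * d = b - a by rewrite /d mulrC divfK// gt_eqF.
  have step k : (k <= n.+1)%N ->
      `|E (a + k%:R * d) - E a| <= d * (psi a - psi (a + k%:R * d)).
    elim: k => [|k IH] kn; first by rewrite mul0r addr0 !subrr normr0 mulr0.
    have le1 : k.+1%:R * d <= n.+1%:R * d by rewrite ler_wpM2r// ler_nat.
    have kd0 : 0 <= k%:R * d by rewrite mulr_ge0.
    have -> : a + k.+1%:R * d = (a + k%:R * d) + d by rewrite -natr1; ring.
    have := H (a + k%:R * d) (a + k%:R * d + d).
    have := IH (ltnW kn).
    have e1 : a <= a + k%:R * d by lra.
    have e2 : a + k%:R * d <= a + k%:R * d + d by lra.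
    have e3 : a + k%:R * d + d <= b by rewrite -natr1 in le1; lra.
    move=> h1 /(_ e1 e2 e3).
    set u := psi (a + k%:R * d); set v := psi _.
    have -> : (a + k%:R * d + d - (a + k%:R * d)) = d by ring.
    move=> h2.
    have -> : d * (psi a - v) = d * (u - v) + d * (psi a - u) by ring.
    apply: (le_trans _ (lerD h2 h1)).
    have -> : E (a + k%:R * d + d) - E a =
      (E (a + k%:R * d + d) - E (a + k%:R * d)) + (E (a + k%:R * d) - E a) by ring.
    exact: ler_normD.
  have := step n.+1 (leqnn _); rewrite dE (_ : a + (b - a) = b); last by ring.
  move=> h.
  by rewrite -dE -mulrA [leLHS]mulrC ler_wpM2l// ltW.
case: (eqVneq (E a) (E b)) => [//|Eab].
have ne0 : 0 < `|E b - E a| by rewrite normr_gt0 subr_eq0 eq_sym.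
set C := (b - a) * (psi a - psi b) in key.
(* Archimedean choice: [n + 1] exceeds [C / |E b - E a|], against [key n]. *)
pose n := Num.truncn (C / `|E b - E a|).
have := key n.
rewrite leNgt => /negP h; exfalso; apply: h.
rewrite -ltr_pdivrMl// mulrC.
by apply: truncnS_gt.
Qed.

(** Fundamental theorem of calculus for [G' = A - B] without continuity of [A] or [B]. The
    increments of [G] and of the integral of [A - B] obey the same bounds, so those of their
    difference are at most [(y - x) (psi x - psi y)] with [psi = A + B]. *)
Lemma integral_nonincr_increments (R : realType) (A B G : R -> R) (a b : R) :
  nonincr A -> nonincr B ->
  (forall t, 0 < t -> 0 <= A t) -> (forall t, 0 < t -> 0 <= B t) ->
  (forall x y, 0 < x -> x <= y ->
     (y - x) * (A y - B x) <= G y - G x <= (y - x) * (A x - B y)) ->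
  0 < a -> a <= b ->
  (\int[lebesgue_measure]_(t in `]a, b]) (A t)%:E + (G a)%:E =
   \int[lebesgue_measure]_(t in `]a, b]) (B t)%:E + (G b)%:E)%E.
Proof.
move=> nA nB A0 B0 HG a0 ab.
pose I f x := fine (\int[lebesgue_measure]_(t in `]a, x]) (f t)%:E)%E : R.
have IE f x : nonincr f -> (forall t, 0 < t -> 0 <= f t) -> a <= x ->
    (\int[lebesgue_measure]_(t in `]a, x]) (f t)%:E)%E = (I f x)%:E.
  move=> nf f0 ax; rewrite /I.
  by have [r -> _] := integral_nonincr_bounds nf f0 a0 ax.
have Iinc f x y : nonincr f -> (forall t, 0 < t -> 0 <= f t) ->
    a <= x -> x <= y -> (y - x) * f y <= I f y - I f x <= (y - x) * f x.
  move=> nf f0 ax xy; have x0 := lt_le_trans a0 ax.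
  have [r re rb] := integral_nonincr_bounds nf f0 x0 xy.
  suff -> : I f y - I f x = r by [].
  have : ((I f y)%:E = (I f x)%:E + r%:E)%E.
    rewrite -!IE ?(le_trans ax)// -re; apply: integral_itvoc_cat => //.
      by apply: measurable_EFin_nonincr => //; apply/subset_itvoc_pos/ltW.
    by move=> t a_t; rewrite lee_fin f0// (lt_trans a0).
  by case=> ->; ring.
have Iaa f : I f a = 0 by rewrite /I set_itvoc0 integral_set0.
rewrite !IE// -!EFinD; congr EFin.
suff : G a + I B a - I A a = G b + I B b - I A b by rewrite !Iaa; lra.
apply: (@eq_of_small_increments _ (fun x => G x + I B x - I A x)
  (fun x => A x + B x) a b ab) => x y ax xy yb.
have x0 := lt_le_trans a0 ax.
have /andP[h1 h2] := HG _ _ x0 xy.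
have /andP[h3 h4] := Iinc _ _ _ nA A0 ax xy.
have /andP[h5 h6] := Iinc _ _ _ nB B0 ax xy.
rewrite !mulrBr in h1 h2 *.
by rewrite ler_norml; apply/andP; split; rewrite mulrDr mulrDr; lra.
Qed.

(** * Tangent inequalities for real powers *)

Lemma powR_le_line (R : realType) (t x : R) :
  0 <= t <= 1 -> 0 <= x -> x `^ t <= 1 + t * (x - 1).
Proof.
move=> /andP[t0 t1] x0.
case: (ltgtP 0 t) t0 => // [t0 _|<- _]; last by rewrite powRr0 mul0r addr0.
case: (ltgtP t 1) t1 => // [t1 _|-> _]; last by rewrite powRr1//; lra.
have s0 : 0 < 1 - t by rewrite subr_gt0.
(* Young's inequality for the product of [x ^ t] and 1, with conjugate exponents [1 / t] and
   [1 / (1 - t)]. *)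
have := @conjugate_powR R (x `^ t) 1 t^-1 (1 - t)^-1 (powR_ge0 _ _) ler01.
rewrite !invr_gt0 !invrK => /(_ t0 s0); rewrite -powRrM mulfV ?gt_eqF//.
by rewrite powRr1// powR1 => h; have := h (subrKC _ _); lra.
Qed.

(** Bernoulli's inequality, as the concave case applied to [x ^ t] with exponent [1 / t]. *)
Lemma powR_ge_line (R : realType) (t x : R) :
  1 <= t -> 0 <= x -> 1 + t * (x - 1) <= x `^ t.
Proof.
move=> t1 x0; have t0 : 0 < t by lra.
have h : (x `^ t) `^ t^-1 <= 1 + t^-1 * (x `^ t - 1).
  by apply: powR_le_line; rewrite ?powR_ge0// invr_ge0 ltW//= invf_le1.
move: h; rewrite -powRrM mulfV ?gt_eqF// powRr1//.
rewrite -(ler_pM2l t0) mulrDr mulrA mulfV ?gt_eqF//; lra.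
Qed.

(* The factor [sigma] carries the direction of the inequality: [sigma > 0] for
   [s <= 1], where the power is concave, and [sigma < 0] for [1 <= s]. *)
Lemma powR_tangent (R : realType) (sigma s x c : R) :
  0 < s -> 0 <= sigma * (1 - s) -> 0 <= x -> 0 < c ->
  sigma * x `^ s <= sigma * (c `^ s + s * c `^ (s - 1) * (x - c)).
Proof.
move=> s0 ss x0 c0.
have xc0 : 0 <= x / c by rewrite divr_ge0// ltW.
have line : sigma * (x / c) `^ s <= sigma * (1 + s * (x / c - 1)).
  case: (ltgtP sigma 0) ss => [sg|sg|->] ss; last by rewrite !mul0r.
  - rewrite ler_nM2l//; apply: powR_ge_line => //.
    by move: ss; rewrite nmulr_rge0//; lra.
  - rewrite ler_pM2l//; apply: powR_le_line => //.
    by move: ss; rewrite pmulr_rge0//; lra.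
have cs : c `^ s = c * c `^ (s - 1) by rewrite mulr_powRB1// ltW.
have -> : x `^ s = c `^ s * (x / c) `^ s.
  by rewrite -powRM ?(ltW c0)// mulrC divfK// gt_eqF.
have -> : sigma * (c `^ s + s * c `^ (s - 1) * (x - c)) =
    c `^ s * (sigma * (1 + s * (x / c - 1))).
  by rewrite cs; field; rewrite gt_eqF.
by rewrite mulrCA ler_wpM2l// powR_ge0.
Qed.

Lemma powR_convex_tangent (R : realType) (p x c : R) :
  1 < p -> 0 <= x -> 0 <= c ->
  c `^ p + p * c `^ (p - 1) * (x - c) <= x `^ p.
Proof.
move=> p1 x0; rewrite le_eqVlt => /predU1P[<-|c0].
  rewrite !powR0 ?mulr0 ?mul0r ?addr0 ?powR_ge0//.
    by rewrite subr_eq0 gt_eqF.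
  by rewrite gt_eqF// (lt_trans _ p1).
have := @powR_tangent R (-1) p x c; rewrite !mulN1r lerN2; apply => //; lra.
Qed.

Lemma powRS (R : realType) (s x : R) : 0 < s -> 0 <= x -> x `^ (s + 1) = x * x `^ s.
Proof.
by move=> s0 x0; rewrite -[in RHS](addrK 1 s) mulr_powRB1//; lra.
Qed.

(** * Pointwise inequalities between [u = phi] and [g = h - phi] *)

(** The tangent at [h = u + g] bounds [u ^ s], and [g / h <= 1] compares [g ^ s] with
    [h ^ (s - 1) g]. Taken with weights [u] and [s g], the two bounds add up exactly to the
    right-hand side. *)
Lemma pointwise_indicator_core (R : realType) (sigma s u g : R) :
  0 < s -> 0 <= sigma * (1 - s) -> 0 <= u -> 0 <= g ->
  sigma * (u * u `^ s - s * (g * g `^ s)) <=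
  sigma * ((u + g) `^ s * (u - s * g)).
Proof.
move=> s0 ss u0; rewrite le_eqVlt => /predU1P[<-|g0].
  by rewrite mul0r !mulr0 !subr0 addr0 (mulrC u).
set h := u + g; have h0 : 0 < h by rewrite /h; lra.
set k := h `^ (s - 1).
have hs : h `^ s = h * k by rewrite /k mulr_powRB1// ltW.
have hU := @powR_tangent R sigma s u h s0 ss u0 h0.
have gh : 0 < g / h <= 1 by rewrite divr_gt0//= ler_pdivrMr// mul1r /h; lra.
have gs : g `^ s = h `^ s * (g / h) `^ s.
  by rewrite -powRM ?(ltW h0) ?divr_ge0 ?ltW// mulrC divfK// gt_eqF.
have k0 : 0 < k by rewrite powR_gt0.
have hG : sigma * (k * g) <= sigma * g `^ s.
  have -> : k * g = h `^ s * (g / h) by rewrite hs; field; rewrite gt_eqF.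
  case: (ltgtP sigma 0) ss => [sg|sg|->] ss; last by rewrite !mul0r.
  - rewrite ler_nM2l// gs ler_wpM2l ?powR_ge0//; apply: ge1r_powR => //.
    by move: ss; rewrite nmulr_rge0//; lra.
  - rewrite ler_pM2l// gs ler_wpM2l ?powR_ge0//; apply: ger1_powR => //.
    by move: ss; rewrite pmulr_rge0//; lra.
rewrite hs -/k in hU *.
have e1 := ler_wpM2l u0 hU.
have e2 := ler_wpM2l (mulr_ge0 (ltW s0) (ltW g0)) hG.
have -> : sigma * (h * k * (u - s * g)) =
  u * (sigma * (h * k + s * k * (u - h))) - s * g * (sigma * (k * g)).
  by rewrite /h; ring.
have -> : sigma * (u * u `^ s - s * (g * g `^ s)) =
  u * (sigma * u `^ s) - s * g * (sigma * g `^ s) by ring.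
by rewrite lerB.
Qed.

(* The slope of [x ^ (s + 1)] between [g] and [a] is compared with the
   derivative at the weighted mean of [g] and [a] with weights [1] and [s]. *)
Lemma pointwise_power_core (R : realType) (sigma s a g : R) :
  0 < s -> 0 <= sigma * (1 - s) -> 0 <= a -> 0 <= g ->
  sigma * (g * g `^ s + (s + 1) * (((g + s * a) / (s + 1)) `^ s * (a - g))) <=
  sigma * (a * a `^ s).
Proof.
move=> s0 ss a0 g0; set b := _ / _.
have s10 : s + 1 != 0 by rewrite gt_eqF// addr_gt0.
have sa0 : 0 <= s * a by rewrite mulr_ge0// ltW.
have powk x : 0 < x -> x `^ s = x * x `^ (s - 1).
  by move=> x0; rewrite mulr_powRB1// ltW.
(* The sign of [a - g] decides how [b ^ s] must be bounded: for [g <= a] by the tangent at [a], and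
   for [a < g], in the opposite direction, by Jensen's inequality for the mean [b]. *)
have [ga|ag] := leP g a.
  move: a0; rewrite le_eqVlt => /predU1P[aE|a0].
    have g_0 : g = 0 by apply/le_anti; rewrite g0 aE ga.
    by rewrite g_0 -aE subrr !mul0r !mulr0 addr0 !mulr0.
  have b0 : 0 <= b by rewrite divr_ge0//; lra.
  have hb := @powR_tangent R sigma s b a s0 ss b0 a0.
  have hg := @powR_tangent R sigma s g a s0 ss g0 a0.
  have bE : b - a = (g - a) / (s + 1) by rewrite /b; field.
  rewrite (powk a)// bE in hb hg *; set k := a `^ (s - 1) in hb hg *.
  have e1 := ler_wpM2l g0 hg.
  have cc : 0 <= (s + 1) * (a - g) by rewrite mulr_ge0//; lra.
  have e2 := ler_wpM2l cc hb.
  have -> : sigma * (a * (a * k)) = g * (sigma * (a * k + s * k * (g - a))) +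
    (s + 1) * (a - g) * (sigma * (a * k + s * k * ((g - a) / (s + 1)))) by field.
  have -> : sigma * (g * g `^ s + (s + 1) * (b `^ s * (a - g))) =
    g * (sigma * g `^ s) + (s + 1) * (a - g) * (sigma * b `^ s) by ring.
  exact: lerD.
have b0 : 0 < b by rewrite divr_gt0//; lra.
have hg := @powR_tangent R sigma s g b s0 ss g0 b0.
have ha := @powR_tangent R sigma s a b s0 ss a0 b0.
set k := b `^ (s - 1) in hg ha.
have jensen : sigma * (g `^ s + s * a `^ s) <= sigma * ((s + 1) * b `^ s).
  have e := lerD hg (ler_wpM2l (ltW s0) ha).
  have -> : sigma * ((s + 1) * b `^ s) = sigma * (b `^ s + s * k * (g - b)) +
     s * (sigma * (b `^ s + s * k * (a - b))).
    by rewrite /b; field.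
  by apply: le_trans e; rewrite mulrDr mulrCA.
have gma : 0 <= g - a by lra.
have e1 := ler_wpM2l gma jensen.
have e2 : a * (sigma * g `^ s) <= a * (sigma * a `^ s) + (g - a) * (sigma * (s * a `^ s)).
  move: a0; rewrite le_eqVlt => /predU1P[<-|a0].
    by rewrite powR0 ?gt_eqF// !mul0r !mulr0 addr0.
  have := ler_wpM2l (ltW a0) (@powR_tangent R sigma s g a s0 ss g0 a0).
  by rewrite (powk a)//; lra.
have -> : sigma * (g * g `^ s + (s + 1) * (b `^ s * (a - g))) =
  g * (sigma * g `^ s) - (g - a) * (sigma * ((s + 1) * b `^ s)) by ring.
have : (g - a) * (sigma * (g `^ s + s * a `^ s)) =
  g * (sigma * g `^ s) - a * (sigma * g `^ s) + (g - a) * (sigma * (s * a `^ s)) by ring.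
have : sigma * (a * a `^ s) = a * (sigma * a `^ s) by ring.
lra.
Qed.

(** Both sides agree when [u = 0] or [g = 0]. The choices [sigma = 1] and [sigma = -1] give the
    cases [p <= 2] and [2 <= p]. *)
Lemma pointwise_indicator (R : realType) (sigma p u g : R) :
  1 < p -> 0 <= sigma * (2 - p) -> 0 <= u -> 0 <= g ->
  sigma * (u `^ p + (p - 1) * (u + g) `^ p) <=
  sigma * ((p - 1) * g `^ p + p * (u + g) `^ (p - 1) * u).
Proof.
move=> p1 sp u0 g0; set s := p - 1.
have s0 : 0 < s by rewrite /s; lra.
have pE : p = s + 1 by rewrite /s; lra.
have ss : 0 <= sigma * (1 - s) by rewrite /s opprB addrA.
have := pointwise_indicator_core s0 ss u0 g0.
rewrite pE !powRS ?addr_ge0//; lra.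
Qed.

(* The weight for which [pointwise_power] is an equality to first order at
   [u = (p - 1) g]. *)
Definition lam (R : realType) (p : R) := p * ((p - 1) / p) `^ (p - 1).

Lemma lam_ge0 (R : realType) (p : R) : 1 < p -> 0 <= lam p.
Proof. by move=> p1; rewrite mulr_ge0 ?powR_ge0//; lra. Qed.

(** As [p - 1 <= 1], concavity bounds the power by [1 - (p - 1) / p = 1 / p]. *)
Lemma lam_le1 (R : realType) (p : R) : 1 < p -> p <= 2 -> lam p <= 1.
Proof.
move=> p1 p2; have p0 : 0 < p by lra.
have q0 : 0 <= (p - 1) / p by rewrite divr_ge0//; lra.
have s01 : 0 <= p - 1 <= 1 by lra.
rewrite /lam; apply: le_trans (ler_wpM2l (ltW p0) (powR_le_line s01 q0)) _.
rewrite (_ : _ * _ = 1)//; field; lra.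
Qed.

(** With [a = u / s] the equality case [u = s g] becomes [a = g], and the weighted mean of [g] and
    [a] is [(u + g) / p]. Multiplying the core inequality by [s ^ p] turns the power of this mean
    into the weight [lam p]. *)
Lemma pointwise_power (R : realType) (sigma p u g : R) :
  1 < p -> 0 <= sigma * (2 - p) -> 0 <= u -> 0 <= g ->
  sigma * ((p - 1) `^ p * g `^ p + lam p * (p * (u + g) `^ (p - 1) * u)) <=
  sigma * (u `^ p + lam p * ((p - 1) * (u + g) `^ p)).
Proof.
move=> p1 sp u0 g0; rewrite /lam; set s := p - 1.
have s0 : 0 < s by rewrite /s; lra.
have pE : p = s + 1 by rewrite /s; lra.
have ss : 0 <= sigma * (1 - s) by rewrite /s opprB addrA.
have a0 : 0 <= u / s by rewrite divr_ge0// ltW.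
have := pointwise_power_core s0 ss a0 g0.
have sne : s != 0 by rewrite gt_eqF.
have s1ne : s + 1 != 0 by rewrite gt_eqF// addr_gt0.
rewrite (_ : s * (u / s) = u); last by field.
rewrite pE; clearbody s; clear p1 sp pE.
have ug0 := addr_ge0 u0 g0.
rewrite !powRS ?(ltW s0)//.
have e1 : (s / (s + 1)) `^ s * (u + g) `^ s = s `^ s * ((g + u) / (s + 1)) `^ s.
  have s10 : 0 <= s + 1 by rewrite addr_ge0 ?ltW.
  rewrite -!powRM ?divr_ge0 ?(addrC g) ?(ltW s0)//.
  by congr (_ `^ _); field.
have e2 : u `^ s = s `^ s * (u / s) `^ s.
  by rewrite -powRM ?(ltW s0)// mulrC divfK.
have S0 : 0 <= s * s `^ s by rewrite mulr_ge0 ?powR_ge0// ltW.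
move=> /(ler_wpM2l S0).
move: e1 e2; set X := (u + g) `^ s; set L := (s / (s + 1)) `^ s.
set Y := (_ / _) `^ s; set Z := (u / s) `^ s => e1 e2.
rewrite e2.
have -> : s * s `^ s * (sigma * (u / s * Z)) = sigma * (u * (s `^ s * Z)) by field.
have -> : s * s `^ s * (sigma * (g * g `^ s + (s + 1) * (Y * (u / s - g)))) =
  sigma * (s * s `^ s * (g * g `^ s) + (s + 1) * (s `^ s * Y) * (u - s * g)) by field.
rewrite -e1; lra.
Qed.

(** * Means of nonincreasing functions and the increments of [G] *)

(* [x * h x] plays the role of the primitive of [phi], so that [h] is its mean
   over [0, x] up to a constant of integration. *)
Definition is_mean (R : realType) (phi h : R -> R) : Prop :=
  [/\ nonincr phi, (forall t, 0 < t -> 0 <= phi t),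
      (forall t, 0 < t -> phi t <= h t)
    & forall x y, 0 < x -> x <= y ->
        (y - x) * phi y <= y * h y - x * h x <= (y - x) * phi x].

Lemma mean_ge0 (R : realType) (phi h : R -> R) (t : R) :
  is_mean phi h -> 0 < t -> 0 <= h t.
Proof. by move=> [_ p0 ph _] t0; rewrite (le_trans (p0 _ t0))// ph. Qed.

Lemma mean_nonincr (R : realType) (phi h : R -> R) : is_mean phi h -> nonincr h.
Proof.
move=> [nphi p0 ph inc] x y x0 xy; have y0 := lt_le_trans x0 xy.
have /andP[_ h2] := inc x y x0 xy.
have h3 := ler_wpM2l (_ : 0 <= y - x) (ph x x0).
rewrite -(ler_pM2l y0); have := h3; rewrite subr_ge0 => /(_ xy); lra.
Qed.

(* [(F, x) |-> F ^ p x ^ (1 - p)] is convex; the two bounds are its tangents at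
   the end points of the segment. *)
Lemma mean_power_increments (R : realType) (p : R) (phi h : R -> R) (x y : R) :
  1 < p -> is_mean phi h -> 0 < x -> x <= y ->
  (y - x) * (p * h y `^ (p - 1) * phi y - (p - 1) * h x `^ p) <=
  y * h y `^ p - x * h x `^ p <=
  (y - x) * (p * h x `^ (p - 1) * phi x - (p - 1) * h y `^ p).
Proof.
move=> p1 m x0 xy; have y0 := lt_le_trans x0 xy.
have hx0 := mean_ge0 m x0; have hy0 := mean_ge0 m y0.
have hxy := mean_nonincr m x0 xy.
have [nphi p0 ph inc] := m.
have /andP[i1 i2] := inc x y x0 xy.
have t1 := ler_wpM2l (ltW y0) (powR_convex_tangent p1 hy0 hx0).
have t2 := ler_wpM2l (ltW x0) (powR_convex_tangent p1 hx0 hy0).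
have P0 : 0 < p by lra.
have xP : h x * h x `^ (p - 1) = h x `^ p by rewrite mulr_powRB1.
have yP : h y * h y `^ (p - 1) = h y `^ p by rewrite mulr_powRB1.
have kxy : h y `^ (p - 1) <= h x `^ (p - 1).
  by apply: ge0_ler_powR => //; rewrite subr_ge0 ltW.
have ky0 : 0 <= h y `^ (p - 1) by rewrite powR_ge0.
rewrite -xP -yP in t1 t2 *.
move: kxy ky0 t1 t2; set k := h x `^ (p - 1); set l := h y `^ (p - 1).
move=> kl l0 t1 t2; have k0 := le_trans l0 kl.
have d0 : 0 <= y - x by rewrite subr_ge0.
have phiy := p0 _ y0; have phix := p0 _ x0.
have pk0 : 0 <= p * k by rewrite mulr_ge0// ltW.
have pl0 : 0 <= p * l by rewrite mulr_ge0// ltW.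
have j1 := ler_wpM2l pk0 i1.
have j2 := ler_wpM2l pl0 i2.
have dp : 0 <= (y - x) * p by rewrite mulr_ge0// ltW.
(* The tangents pair [h ^ (p - 1)] at one end point with [phi] at the other. Since [k >= l], these
   mixed products may be exchanged for the ones in the claim. *)
have j3 : 0 <= (y - x) * p * ((k - l) * phi y).
  by rewrite !mulr_ge0 ?subr_ge0// ltW.
have j4 : 0 <= (y - x) * p * ((k - l) * phi x).
  by rewrite !mulr_ge0 ?subr_ge0// ltW.
by apply/andP; split; nra.
Qed.

(** * Integrated comparison on compact intervals *)

Lemma lee_shift (R : realType) (X Y : \bar R) (r s c : R) :
  (X + r%:E <= Y + s%:E)%E -> s - r <= c -> (X <= Y + c%:E)%E.
Proof.
move=> XY src; have : (X <= Y + s%:E - r%:E)%E by rewrite leeBrDr.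
move=> /le_trans; apply; rewrite -addeA leeD2l// -EFinB lee_fin//.
Qed.

(** All four integrands are nonnegative and none is subtracted, so linearity of the integral
    requires no integrability. *)
Lemma integral_comparison (R : realType) (D : set R) (X Y A B : R -> R)
    (K L l : R) :
  measurable D -> measurable_fun D X -> measurable_fun D Y ->
  measurable_fun D A -> measurable_fun D B ->
  (forall t, D t -> [/\ 0 <= X t, 0 <= Y t, 0 <= A t & 0 <= B t]) ->
  0 <= K -> 0 <= L -> 0 <= l ->
  (forall t, D t -> K * X t + l * A t <= L * Y t + l * B t) ->
  (K%:E * \int[lebesgue_measure]_(t in D) (X t)%:E +
   l%:E * \int[lebesgue_measure]_(t in D) (A t)%:E <=
   L%:E * \int[lebesgue_measure]_(t in D) (Y t)%:E +
   l%:E * \int[lebesgue_measure]_(t in D) (B t)%:E)%E.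
Proof.
move=> mD mX mY mA mB ge0 K0 L0 l0 H.
have lin (Z C : R -> R) (k : R) : measurable_fun D Z -> measurable_fun D C ->
    (forall t, D t -> 0 <= Z t) -> (forall t, D t -> 0 <= C t) -> 0 <= k ->
    (k%:E * \int[lebesgue_measure]_(t in D) (Z t)%:E +
     l%:E * \int[lebesgue_measure]_(t in D) (C t)%:E =
     \int[lebesgue_measure]_(t in D) (k * Z t + l * C t)%:E)%E.
  move=> mZ mC Z0 C0 k0.
  have mZ' := (measurable_EFinP D Z).2 mZ.
  have mC' := (measurable_EFinP D C).2 mC.
  have Z0' t : D t -> (0 <= (Z t)%:E)%E by move=> Dt; rewrite lee_fin Z0.
  have C0' t : D t -> (0 <= (C t)%:E)%E by move=> Dt; rewrite lee_fin C0.
  rewrite -!ge0_integralZl_EFin// -ge0_integralD//.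
  - by move=> t Dt; rewrite mule_ge0// Z0'.
  - exact: measurable_funeM.
  - by move=> t Dt; rewrite mule_ge0// C0'.
  - exact: measurable_funeM.
rewrite !lin//; [|by move=> t /ge0[]..].
have mlin (Z C : R -> R) (k : R) : measurable_fun D Z -> measurable_fun D C ->
    measurable_fun D (fun t => (k * Z t + l * C t)%:E).
  move=> mZ mC; apply/measurable_EFinP; apply: measurable_funD;
    exact: measurable_funM.
apply: ge0_le_integral; [exact: mD| |exact: mlin|exact: mlin|].
  move=> t /ge0[X0 _ A0 _]; by rewrite lee_fin addr_ge0// mulr_ge0.
by move=> t Dt; rewrite lee_fin H.
Qed.

(** Integrated form of the formula for [G']. Both integrands are products of nonnegative
    nonincreasing factors, so the increment bounds suffice and both integrals are finite. *)
Lemma mean_identity (R : realType) (p : R) (phi h : R -> R) (a b : R) :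
  1 < p -> is_mean phi h -> 0 < a -> a <= b ->
  exists v w, [/\
    (\int[lebesgue_measure]_(t in `]a, b]) (p * h t `^ (p - 1) * phi t)%:E = v%:E)%E,
    (\int[lebesgue_measure]_(t in `]a, b]) ((p - 1) * h t `^ p)%:E = w%:E)%E
    & v + a * h a `^ p = w + b * h b `^ p].
Proof.
move=> p1 m a0 ab; have [nphi p0 ph inc] := m.
have h0 t : 0 < t -> 0 <= h t by exact: mean_ge0 m.
have nh := mean_nonincr m.
pose A t := p * h t `^ (p - 1) * phi t; pose B t := (p - 1) * h t `^ p.
have npow r : 0 <= r -> nonincr (fun t => h t `^ r).
  move=> r0 x y x0 xy; apply: ge0_ler_powR => //.
  - by rewrite nnegrE h0// (lt_le_trans x0).
  - by rewrite nnegrE h0.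
  - exact: nh.
have P0 : 0 <= p by lra. have P10 : 0 <= p - 1 by lra.
have nA : nonincr A.
  move=> x y x0 xy; rewrite /A; have y0 := lt_le_trans x0 xy.
  apply: ler_pM; rewrite ?mulr_ge0 ?powR_ge0 ?p0//; last exact: nphi.
  by rewrite ler_wpM2l//; apply: npow.
have nB : nonincr B.
  by move=> x y x0 xy; rewrite /B ler_wpM2l//; apply: npow.
have A0 t : 0 < t -> 0 <= A t by move=> t0; rewrite !mulr_ge0 ?powR_ge0 ?p0.
have B0 t : 0 < t -> 0 <= B t by move=> t0; rewrite mulr_ge0 ?powR_ge0.
have [v ve _] := integral_nonincr_bounds nA A0 a0 ab.
have [w we _] := integral_nonincr_bounds nB B0 a0 ab.
exists v, w; split => //.
have := @integral_nonincr_increments R A B (fun x => x * h x `^ p) a b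
  nA nB A0 B0 (fun x y x0 xy => mean_power_increments p1 m x0 xy) a0 ab.
by rewrite ve we => -[].
Qed.

Section interval_comparison.
Variables (R : realType) (p K l : R) (phi h : R -> R) (a b : R).
Hypotheses (p1 : 1 < p) (K0 : 0 <= K) (l0 : 0 <= l) (m : is_mean phi h).
Hypotheses (a0 : 0 < a) (ab : a <= b).

Let mphi : measurable_fun `]a, b] phi.
Proof.
by case: m => nphi _ _ _; apply: measurable_nonincr => //; apply/subset_itvoc_pos/ltW.
Qed.

Let mh : measurable_fun `]a, b] h.
Proof.
apply: measurable_nonincr => //; first exact: mean_nonincr m.
exact/subset_itvoc_pos/ltW.
Qed.

Let mpow r (f : R -> R) :
  measurable_fun `]a, b] f -> measurable_fun `]a, b] (fun t => f t `^ r).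
Proof. by move=> mf; apply: (measurableT_comp (measurable_powR r)). Qed.

Let mg : measurable_fun `]a, b] (fun t => (h t - phi t) `^ p).
Proof. by apply: mpow; exact: measurable_funB. Qed.

Let ge0 t : `]a, b]%classic t ->
  [/\ 0 <= (h t - phi t) `^ p, 0 <= phi t `^ p,
      0 <= p * h t `^ (p - 1) * phi t & 0 <= (p - 1) * h t `^ p].
Proof.
rewrite /= in_itv/= => /andP[a_t _]; case: m => _ p0 _ _.
have t0 := lt_trans a0 a_t; have P0 : 0 <= p by exact: ltW (lt_trans ltr01 p1).
by rewrite !mulr_ge0 ?powR_ge0 ?p0// subr_ge0 ltW.
Qed.

(** The boundary term at [b] has the favourable sign and is dropped; in the reverse comparison below
    it is the one at [a]. *)
Lemma mean_lower_comparison :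
  (forall t, 0 < t ->
     K * (h t - phi t) `^ p + l * (p * h t `^ (p - 1) * phi t) <=
     phi t `^ p + l * ((p - 1) * h t `^ p)) ->
  (K%:E * \int[lebesgue_measure]_(t in `]a, b]) ((h t - phi t) `^ p)%:E <=
   \int[lebesgue_measure]_(t in `]a, b]) (phi t `^ p)%:E + (l * (a * h a `^ p))%:E)%E.
Proof.
move=> H; have [v [w [ve we vw]]] := mean_identity p1 m a0 ab.
have := @integral_comparison R `]a, b]%classic
  (fun t => (h t - phi t) `^ p) (fun t => phi t `^ p)
  (fun t => p * h t `^ (p - 1) * phi t) (fun t => (p - 1) * h t `^ p) K 1 l.
rewrite ve we mul1e.
move=> /(_ (measurable_itv _) mg (mpow p mphi)).
have mA : measurable_fun `]a, b] (fun t => p * h t `^ (p - 1) * phi t).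
  by apply: measurable_funM => //; apply: measurable_funM => //; exact: mpow.
have mB : measurable_fun `]a, b] (fun t => (p - 1) * h t `^ p).
  by apply: measurable_funM => //; exact: mpow.
move=> /(_ mA mB ge0 K0 ler01 l0).
have H' t : `]a, b]%classic t ->
     K * (h t - phi t) `^ p + l * (p * h t `^ (p - 1) * phi t) <=
     1 * phi t `^ p + l * ((p - 1) * h t `^ p).
  by rewrite /= in_itv/= mul1r => /andP[a_t _]; apply: H; exact: lt_trans a_t.
move=> /(_ H').
rewrite -!EFinM => /lee_shift; apply.
have hb : 0 <= l * (b * h b `^ p).
  by rewrite !mulr_ge0 ?powR_ge0// ltW// (lt_le_trans a0).
have -> : w = v + a * h a `^ p - b * h b `^ p by lra.
rewrite !mulrDr; lra.
Qed.

Lemma mean_upper_comparison :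
  (forall t, 0 < t ->
     phi t `^ p + l * ((p - 1) * h t `^ p) <=
     K * (h t - phi t) `^ p + l * (p * h t `^ (p - 1) * phi t)) ->
  (\int[lebesgue_measure]_(t in `]a, b]) (phi t `^ p)%:E <=
   K%:E * \int[lebesgue_measure]_(t in `]a, b]) ((h t - phi t) `^ p)%:E +
   (l * (b * h b `^ p))%:E)%E.
Proof.
move=> H; have [v [w [ve we vw]]] := mean_identity p1 m a0 ab.
have := @integral_comparison R `]a, b]%classic
  (fun t => phi t `^ p) (fun t => (h t - phi t) `^ p)
  (fun t => (p - 1) * h t `^ p) (fun t => p * h t `^ (p - 1) * phi t) 1 K l.
rewrite ve we mul1e.
move=> /(_ (measurable_itv _) (mpow p mphi) mg).
have mA : measurable_fun `]a, b] (fun t => p * h t `^ (p - 1) * phi t).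
  by apply: measurable_funM => //; apply: measurable_funM => //; exact: mpow.
have mB : measurable_fun `]a, b] (fun t => (p - 1) * h t `^ p).
  by apply: measurable_funM => //; exact: mpow.
have ge0' t : `]a, b]%classic t ->
  [/\ 0 <= phi t `^ p, 0 <= (h t - phi t) `^ p, 0 <= (p - 1) * h t `^ p
    & 0 <= p * h t `^ (p - 1) * phi t] by move=> /ge0[].
move=> /(_ mB mA ge0' ler01 K0 l0).
have H' t : `]a, b]%classic t ->
     1 * phi t `^ p + l * ((p - 1) * h t `^ p) <=
     K * (h t - phi t) `^ p + l * (p * h t `^ (p - 1) * phi t).
  by rewrite /= in_itv/= mul1r => /andP[a_t _]; apply: H; exact: lt_trans a_t.
move=> /(_ H').
rewrite -!EFinM => /lee_shift; apply.
have ha : 0 <= l * (a * h a `^ p) by rewrite !mulr_ge0 ?powR_ge0// ltW.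
have -> : w = v + a * h a `^ p - b * h b `^ p by lra.
rewrite !mulrDr; lra.
Qed.

End interval_comparison.

(** * Passage to the half-line and the primitive of [phi] *)

(** Monotone convergence along the intervals []1 / (n + 1), n + 1]]. *)
Lemma integral_pos_le (R : realType) (f : R -> \bar R) (C : \bar R) :
  measurable_fun (`]0, +oo[ : set R) f -> (forall t, 0 < t -> (0 <= f t)%E) ->
  (forall a b, 0 < a -> a <= b ->
     (\int[lebesgue_measure]_(t in `]a, b]) f t <= C)%E) ->
  (\int[lebesgue_measure]_(t in `]0%R, +oo[) f t <= C)%E.
Proof.
move=> mf f0 H.
pose F (n : nat) : set R := `]n.+1%:R^-1, n.+1%:R]%classic.
have Fpos n : F n `<=` `]0, +oo[ by apply: subset_itvoc_pos.
have FE : \bigcup_n F n = `]0, +oo[%classic.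
  apply/seteqP; split => [t [n _ /Fpos//]|t /=]; rewrite in_itv/= andbT => t0.
  pose n := maxn (Num.truncn t) (Num.truncn t^-1).
  exists n => //=; rewrite /F /= in_itv/=; apply/andP; split.
    rewrite -[ltRHS]invrK ltf_pV2 ?posrE ?invr_gt0//.
    by apply: lt_le_trans (truncnS_gt _) _; rewrite ler_nat ltnS leq_maxr.
  by apply/ltW/(lt_le_trans (truncnS_gt _)); rewrite ler_nat ltnS leq_maxl.
rewrite -FE.
have cv : (\int[lebesgue_measure]_(x in F i) f x)%E @[i --> \oo] -->
    (\int[lebesgue_measure]_(x in \bigcup_i F i) f x)%E.
  apply: ge0_nondecreasing_set_cvg_integral.
  - apply/nondecreasing_seqP => n; rewrite subsetEset => t /=.
    rewrite /F /= !in_itv/= => /andP[t1 t2]; apply/andP; split.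
      by apply: le_lt_trans t1; rewrite lef_pV2 ?posrE// ler_nat.
    by apply: le_trans t2 _; rewrite ler_nat.
  - by move=> i; exact: measurable_itv.
  - by move=> i; apply: measurable_funS mf.
  - by move=> i x /Fpos /=; rewrite in_itv/= andbT; exact: f0.
rewrite -(cvg_lim _ cv)//; apply: lime_le; first by apply/cvg_ex; eexists; exact: cv.
apply: nearW => n; apply: H; first by rewrite invr_gt0.
by rewrite (@le_trans _ _ 1)// ?invf_le1 ?ler1n.
Qed.

(** [fine] sends an infinite integral to 0, so this is the primitive of [phi] only under
    [near0_integrable]. *)
Definition cumul (R : realType) (phi : R -> R) (x : R) : R :=
  fine (\int[lebesgue_measure]_(t in `]0%R, x]) (phi t)%:E)%E.

Definition near0_integrable (R : realType) (phi : R -> R) : Prop :=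
  forall x, 0 < x -> (\int[lebesgue_measure]_(t in `]0%R, x]) (phi t)%:E < +oo)%E.

Section mean_of_nonincr.
Variables (R : realType) (phi : R -> R).
Hypotheses (nphi : nonincr phi) (p0 : forall t, 0 < t -> 0 <= phi t).

Lemma integral_itv0_ge0 (x : R) :
  (0 <= \int[lebesgue_measure]_(t in `]0%R, x]) (phi t)%:E)%E.
Proof.
by apply: integral_ge0 => t /=; rewrite in_itv/= lee_fin => /andP[t0 _]; exact: p0.
Qed.

Lemma integral_itv0_cat (x y : R) : 0 < x -> x <= y ->
  (\int[lebesgue_measure]_(t in `]0%R, y]) (phi t)%:E =
   \int[lebesgue_measure]_(t in `]0%R, x]) (phi t)%:E +
   \int[lebesgue_measure]_(t in `]x, y]) (phi t)%:E)%E.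
Proof.
move=> x0 xy; apply: integral_itvoc_cat => //; first exact: ltW.
  by apply: measurable_EFin_nonincr => //; exact: subset_itvoc_pos.
Qed.

Lemma hardy_pos (x : R) : 0 < x ->
  hardy phi x =
    ((x^-1)%:E * \int[lebesgue_measure]_(t in `]0%R, x]) (phi t)%:E)%E.
Proof.
move=> x0; rewrite /hardy integral_itv_bndo_bndc//.
apply: measurable_EFin_nonincr => //.
by move=> t /=; rewrite !in_itv/= andbT => /andP[].
Qed.

(** Divergence can only come from 0, because [phi] is bounded on []x, y]] for [x > 0]. An infinite
    integral over one []0, y]] therefore makes all of them infinite. *)
Lemma not_near0_integrable : ~ near0_integrable phi ->
  forall x, 0 < x -> hardy_sub phi x = +oo%E.
Proof.
move=> ni x x0.
suff e : (\int[lebesgue_measure]_(t in `]0%R, x]) (phi t)%:E = +oo)%E.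
  by rewrite /hardy_sub hardy_pos// e gt0_muley// lte_fin invr_gt0.
move: ni => /existsNP[y /not_implyP[y0 /negP]]; rewrite -leNgt leye_eq => /eqP ye.
have [xy|/ltW yx] := leP x y.
  have [r re _] := integral_nonincr_bounds nphi p0 x0 xy.
  move: ye; rewrite (integral_itv0_cat x0 xy) re.
  by case: (\int[_]_(_ in _) _)%E.
apply/eqP; rewrite -leye_eq -ye; apply: ge0_subset_integral => //.
- by apply: measurable_EFin_nonincr => //; exact: subset_itvoc_pos.
- by move=> t /=; rewrite in_itv/= lee_fin => /andP[t0 _]; exact: p0.
- by move=> t /=; rewrite !in_itv/= => /andP[-> /le_trans->].
Qed.

Hypothesis fin : near0_integrable phi.

Lemma cumulE (x : R) : 0 < x ->
  (\int[lebesgue_measure]_(t in `]0%R, x]) (phi t)%:E)%E = (cumul phi x)%:E.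
Proof.
by move=> x0; rewrite /cumul fineK// ge0_fin_numE ?fin// integral_itv0_ge0.
Qed.

Lemma cumul_increments (x y : R) : 0 < x -> x <= y ->
  (y - x) * phi y <= cumul phi y - cumul phi x <= (y - x) * phi x.
Proof.
move=> x0 xy; have [r re rb] := integral_nonincr_bounds nphi p0 x0 xy.
suff -> : cumul phi y - cumul phi x = r by [].
have := integral_itv0_cat x0 xy.
by rewrite re !cumulE ?(lt_le_trans x0)// => -[->]; ring.
Qed.

Lemma cumul_ge (x : R) : 0 < x -> x * phi x <= cumul phi x.
Proof.
move=> x0; rewrite -lee_fin -cumulE//.
have mx : lebesgue_measure (`]0, x] : set R) = x%:E.
  by rewrite lebesgue_measure_itv/= lte_fin x0 oppr0 adde0.
rewrite mulrC EFinM -mx -integral_cst//; apply: ge0_le_integral => //.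
- by move=> t _; rewrite lee_fin p0.
- by apply: measurable_EFin_nonincr => //; exact: subset_itvoc_pos.
- by move=> t /=; rewrite in_itv/= lee_fin => /andP[t0 tx]; exact: nphi.
Qed.

Lemma is_mean_cumul : is_mean phi (fun x => cumul phi x / x).
Proof.
split => // [t t0|x y x0 xy]; first by rewrite ler_pdivlMr// mulrC cumul_ge.
have y0 := lt_le_trans x0 xy.
by rewrite ![_ * (_ / _)]mulrC !divfK ?gt_eqF// cumul_increments.
Qed.

Lemma hardy_sub_cumul (x : R) : 0 < x ->
  hardy_sub phi x = (cumul phi x / x - phi x)%:E.
Proof. by move=> x0; rewrite /hardy_sub hardy_pos// cumulE// -EFinM mulrC EFinB. Qed.

End mean_of_nonincr.

Section powers_of_nonincr.
Variables (R : realType) (p : R) (phi : R -> R).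
Hypotheses (p1 : 1 < p).
Hypotheses (nphi : nonincr phi) (p0 : forall t, 0 < t -> 0 <= phi t).

Lemma measurable_power_nonincr (D : set R) :
  measurable D -> D `<=` `]0, +oo[ -> measurable_fun D (fun t => phi t `^ p).
Proof.
move=> mD D0; apply: (measurableT_comp (measurable_powR p)).
exact: measurable_nonincr.
Qed.

(** The tangent inequality at [c], integrated. The parameter is used twice: [c = 1] gives
    integrability near 0, and [c] equal to the mean of [phi] gives Jensen's inequality. *)
Lemma jensen_itv0 (c x : R) : 0 <= c -> 0 < x ->
  ((p * c `^ (p - 1))%:E * \int[lebesgue_measure]_(t in `]0%R, x]) (phi t)%:E <=
   \int[lebesgue_measure]_(t in `]0%R, x]) (phi t `^ p)%:E +
   ((p - 1) * c `^ p * x)%:E)%E.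
Proof.
move=> c0 x0.
have mx : lebesgue_measure (`]0, x] : set R) = x%:E.
  by rewrite lebesgue_measure_itv/= lte_fin x0 oppr0 adde0.
have sub : `]0, x] `<=` (`]0, +oo[ : set R) by exact: subset_itvoc_pos.
have k0 : 0 <= (p - 1) * c `^ p by rewrite mulr_ge0 ?powR_ge0// subr_ge0 ltW.
rewrite [((p - 1) * c `^ p * x)%:E]EFinM -mx -integral_cst//.
have := @integral_comparison R `]0, x]%classic phi (fun t => phi t `^ p)
  (cst 0) (cst ((p - 1) * c `^ p)) (p * c `^ (p - 1)) 1 1.
rewrite !mul1e integral0 adde0; apply => //.
- exact: measurable_nonincr.
- exact: measurable_power_nonincr.
- by move=> t /sub /=; rewrite in_itv/= andbT => t0; rewrite powR_ge0 p0.
- by rewrite mulr_ge0 ?powR_ge0// ltW// (lt_trans ltr01).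
- move=> t /sub /=; rewrite in_itv/= andbT => t0.
  have := powR_convex_tangent p1 (p0 t0) c0.
  have := @mulr_powRB1 R c p c0 (lt_trans ltr01 p1).
  by move=> <-; lra.
Qed.

Lemma power_integral_itv0_le (x : R) : 0 < x ->
  (\int[lebesgue_measure]_(t in `]0%R, x]) (phi t `^ p)%:E <=
   \int[lebesgue_measure]_(t in `]0%R, +oo[) (phi t `^ p)%:E)%E.
Proof.
move=> x0; apply: ge0_subset_integral => //.
- by apply/measurable_EFinP; exact: measurable_power_nonincr.
- by move=> t _; rewrite lee_fin powR_ge0.
- exact: subset_itvoc_pos.
Qed.

Lemma near0_integrable_power :
  (\int[lebesgue_measure]_(t in `]0%R, +oo[) (phi t `^ p)%:E < +oo)%E ->
  near0_integrable phi.
Proof.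
move=> fin x x0; have := jensen_itv0 ler01 x0.
have := le_lt_trans (power_integral_itv0_le x0) fin.
rewrite powR1 mulr1; case: (\int[_]_(_ in _) (_ `^ _)%:E)%E => [r| |]//.
- move=> _; case: (\int[_]_(_ in _) _)%E => // [s|]; first by rewrite ltry.
  by rewrite gt0_muley ?lte_fin ?(lt_trans ltr01)// -EFinD leye_eq.
- move=> _; case: (\int[_]_(_ in _) _)%E => //.
  by rewrite gt0_muley ?lte_fin ?(lt_trans ltr01).
Qed.

End powers_of_nonincr.

(** * Integral inequalities on the half-line *)

Lemma measurable_defect (R : realType) (p : R) (phi h : R -> R) (D : set R) :
  is_mean phi h -> measurable D -> D `<=` `]0, +oo[ ->
  measurable_fun D (fun t => (h t - phi t) `^ p).
Proof.
move=> m mD D0; apply: (measurableT_comp (measurable_powR p)).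
apply: measurable_funB; apply: measurable_nonincr => //.
  exact: mean_nonincr m.
by case: m.
Qed.

(* The boundary term [a h(a)^p] left over at [a] is absorbed, by Jensen's
   inequality, in the integral of [phi^p] over [0, a]; this needs [l <= 1]. *)
Lemma cumul_lower (R : realType) (p K l : R) (phi : R -> R) :
  let h x := cumul phi x / x in
  1 < p -> 0 <= K -> 0 <= l <= 1 ->
  nonincr phi -> (forall t, 0 < t -> 0 <= phi t) -> near0_integrable phi ->
  (forall t, 0 < t ->
     K * (h t - phi t) `^ p + l * (p * h t `^ (p - 1) * phi t) <=
     phi t `^ p + l * ((p - 1) * h t `^ p)) ->
  (K%:E * \int[lebesgue_measure]_(t in `]0%R, +oo[) ((h t - phi t) `^ p)%:E <=
   \int[lebesgue_measure]_(t in `]0%R, +oo[) (phi t `^ p)%:E)%E.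
Proof.
move=> h p1 K0 /andP[l0 l1] nphi p0 fin H.
have m : is_mean phi h := is_mean_cumul nphi p0 fin.
have mg D := @measurable_defect R p phi h D m.
rewrite -ge0_integralZl_EFin//; last 2 first.
  by move=> t _; rewrite lee_fin powR_ge0.
  by apply/measurable_EFinP; apply: mg.
apply: integral_pos_le.
- by apply: measurable_funeM; apply/measurable_EFinP; apply: mg.
- by move=> t _; rewrite mule_ge0// lee_fin ?powR_ge0.
move=> a b a0 ab; have b0 := lt_le_trans a0 ab.
have sab : `]a, b] `<=` (`]0, +oo[ : set R) by apply/subset_itvoc_pos/ltW.
rewrite ge0_integralZl_EFin//; last 2 first.
  by move=> t _; rewrite lee_fin powR_ge0.
  by apply/measurable_EFinP; apply: mg.
apply: le_trans (mean_lower_comparison p1 K0 l0 m a0 ab H) _.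
apply: le_trans _ (power_integral_itv0_le p nphi b0).
rewrite (integral_itvoc_cat (ltW a0) ab); last 2 first.
  by apply/measurable_EFinP; apply: measurable_power_nonincr => //; exact: subset_itvoc_pos.
  by move=> t _; rewrite lee_fin powR_ge0.
rewrite addeC leeD2r//.
have ha0 : 0 <= h a := mean_ge0 m a0.
have := jensen_itv0 p1 nphi p0 ha0 a0.
rewrite cumulE//.
have -> : cumul phi a = h a * a by rewrite /h divfK// gt_eqF.
rewrite -EFinM => J.
(* For [c = h a] the left side of [J] is [p a h(a)^p]; cancelling the [(p - 1) a h(a)^p] on the
   right leaves one copy. *)
have : (((a * h a `^ p))%:E <=
    \int[lebesgue_measure]_(t in `]0%R, a]) (phi t `^ p)%:E)%E.
  rewrite -[leRHS]adde0.
  apply: (@lee_shift _ _ _ ((p - 1) * (a * h a `^ p)) ((p - 1) * (a * h a `^ p))).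
    rewrite -EFinD; move: J.
    have := @mulr_powRB1 R (h a) p ha0 (lt_trans ltr01 p1) => <-.
    congr (_%:E <= _ + _%:E)%E; ring.
  by rewrite subrr.
apply: le_trans; rewrite lee_fin ler_piMl// mulr_ge0 ?powR_ge0//; exact: ltW.
Qed.

(* If [phi] vanishes beyond [N], the boundary term [b h(b)^p] equals
   [c (c / b)^(p - 1)] for the constant [c = cumul phi N] and [b >= N], and so
   tends to [0]. *)
Lemma cumul_upper_support (R : realType) (p K l N : R) (phi : R -> R) :
  let h x := cumul phi x / x in
  1 < p -> 0 <= K -> 0 <= l -> 0 < N -> (forall t, N <= t -> phi t = 0) ->
  nonincr phi -> (forall t, 0 < t -> 0 <= phi t) -> near0_integrable phi ->
  (forall t, 0 < t ->
     phi t `^ p + l * ((p - 1) * h t `^ p) <=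
     K * (h t - phi t) `^ p + l * (p * h t `^ (p - 1) * phi t)) ->
  (\int[lebesgue_measure]_(t in `]0%R, +oo[) (phi t `^ p)%:E <=
   K%:E * \int[lebesgue_measure]_(t in `]0%R, +oo[) ((h t - phi t) `^ p)%:E)%E.
Proof.
move=> h p1 K0 l0 N0 phiN nphi p0 fin H.
have m : is_mean phi h := is_mean_cumul nphi p0 fin.
have mg D := @measurable_defect R p phi h D m.
apply: integral_pos_le.
- by apply/measurable_EFinP; apply: measurable_power_nonincr.
- by move=> t _; rewrite lee_fin powR_ge0.
move=> a b a0 ab; have b0 := lt_le_trans a0 ab.
apply/lee_addgt0Pr => e e0.
pose c := cumul phi N.
have c0 : 0 <= c by apply: le_trans (cumul_ge nphi p0 fin N0); rewrite phiN// mulr0.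
have lc0 : 0 < l * c + 1 by rewrite ltr_wpDl// mulr_ge0.
(* Chosen so that [l c z^(p - 1) <= e]; the added 1 avoids division by 0. Since [b' >= c / z], the
   mean [c / b'] is at most [z]. *)
pose z := (e / (l * c + 1)) `^ (p - 1)^-1.
have z0 : 0 < z by rewrite powR_gt0// divr_gt0.
pose b' := b + N + c / z.
have cz0 : 0 <= c / z by rewrite divr_ge0// ltW.
have bb' : b <= b' by rewrite /b' -addrA lerDl addr_ge0// ltW.
have Nb' : N <= b' by rewrite /b' addrAC addrC lerDl addr_ge0// ltW.
have b'0 := lt_le_trans b0 bb'.
have cE : cumul phi b' = c.
  have := cumul_increments nphi p0 fin N0 Nb'.
  by rewrite !phiN// !mulr0 => /le_anti/eqP; rewrite eq_sym subr_eq0 => /eqP.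
have cb : c / b' <= z.
  rewrite ler_pdivrMr// mulrC -ler_pdivrMr// /b'; lra.
have hb : l * (b' * h b' `^ p) <= e.
  have h0 : 0 <= h b' := mean_ge0 m b'0.
  rewrite -(mulr_powRB1 h0 (lt_trans ltr01 p1)) /h cE !mulrA.
  have -> : l * b' * c / b' = l * c by field; rewrite gt_eqF.
  have : (c / b') `^ (p - 1) <= e / (l * c + 1).
    have -> : e / (l * c + 1) = z `^ (p - 1).
      rewrite /z -powRrM mulVf ?gt_eqF ?subr_gt0// powRr1//.
      by rewrite divr_ge0// ltW.
    by apply: ge0_ler_powR; rewrite ?nnegrE ?divr_ge0 ?subr_ge0// ltW.
  have lc : 0 <= l * c by rewrite mulr_ge0.
  move=> /(ler_wpM2l lc) /le_trans; apply.
  by rewrite mulrA ler_pdivrMr// mulrC ler_pM2l// lerDl.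
apply: (@le_trans _ _ (\int[lebesgue_measure]_(t in `]a, b']) (phi t `^ p)%:E)%E).
  have sub : `]a, b'] `<=` (`]0, +oo[ : set R) by apply/subset_itvoc_pos/ltW.
  apply: ge0_subset_integral => //.
  - by apply/measurable_EFinP; apply: measurable_power_nonincr.
  - by move=> t _; rewrite lee_fin powR_ge0.
  - by move=> t /=; rewrite !in_itv/= => /andP[-> /le_trans->].
apply: le_trans (mean_upper_comparison p1 K0 l0 m a0 (le_trans ab bb') H) _.
apply: leeD; last by rewrite lee_fin.
apply: lee_wpmul2l; first by rewrite lee_fin.
apply: ge0_subset_integral => //.
- by apply/measurable_EFinP; apply: mg.
- by move=> t _; rewrite lee_fin powR_ge0.
- exact/subset_itvoc_pos/ltW.
Qed.

Section lowered.
Variables (R : realType) (phi : R -> R) (d : R).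
Hypotheses (nphi : nonincr phi) (p0 : forall t, 0 < t -> 0 <= phi t).
Hypotheses (fin : near0_integrable phi) (d0 : 0 <= d).

Definition lowered (t : R) : R := Num.max (phi t - d) 0.

Lemma lowered_nonincr : nonincr lowered.
Proof.
move=> x y x0 xy; have := nphi x0 xy; rewrite /lowered => h.
by rewrite ge_max le_max lerB// le_max lexx orbT.
Qed.

Lemma lowered_ge0 t : 0 <= lowered t.
Proof. by rewrite /lowered le_max lexx orbT. Qed.

Lemma lowered_le t : 0 < t -> lowered t <= phi t.
Proof. by move=> t0; rewrite /lowered ge_max p0// andbT lerBlDr lerDl. Qed.

Lemma le_lowered t : phi t - d <= lowered t.
Proof. by rewrite /lowered le_max lexx. Qed.

Let itv_pos (x t : R) : `]0, x]%classic t -> 0 < t.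
Proof. by rewrite /= in_itv/= => /andP[]. Qed.

Let near0_sub (f : R -> R) : nonincr f -> (forall t, 0 < t -> 0 <= f t) ->
  (forall t, 0 < t -> f t <= phi t) -> near0_integrable f.
Proof.
move=> nf f0 fphi x x0; apply: le_lt_trans (fin x0); apply: ge0_le_integral => //.
- by move=> t /itv_pos t0; rewrite lee_fin f0.
- by apply: measurable_EFin_nonincr => //; exact: subset_itvoc_pos.
- by apply: measurable_EFin_nonincr => //; exact: subset_itvoc_pos.
- by move=> t /itv_pos t0; rewrite lee_fin fphi.
Qed.

Lemma lowered_near0 : near0_integrable lowered.
Proof.
apply: near0_sub; [exact: lowered_nonincr|by move=> *; exact: lowered_ge0|exact: lowered_le].
Qed.

(* [phi - lowered] is itself nonincreasing, hence at most its mean. *)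
Lemma lowered_defect (x : R) : 0 < x ->
  cumul lowered x / x - lowered x <= cumul phi x / x - phi x.
Proof.
move=> x0; pose m t := phi t - lowered t.
have mE t : m t = Num.min d (phi t).
  rewrite /m /lowered; case: (leP (phi t - d) 0) => h; case: (leP d (phi t)) => h'; lra.
have nm : nonincr m.
  move=> u v u0 uv; rewrite !mE; have := nphi u0 uv => h.
  by rewrite le_min !ge_min lexx h orbT.
have m0 t : 0 < t -> 0 <= m t by move=> t0; rewrite mE le_min d0 p0.
have fm : near0_integrable m.
  by apply: near0_sub => // t t0; rewrite /m lerBlDr lerDl lowered_ge0.
have h := cumul_ge nm m0 fm x0.
have e : cumul phi x = cumul lowered x + cumul m x.
  apply: EFin_inj; rewrite EFinD -(cumulE p0 fin x0) -(cumulE m0 fm x0).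
  rewrite -(cumulE (fun t _ => lowered_ge0 t) lowered_near0 x0).
  rewrite -ge0_integralD//.
  - by apply: eq_integral => t _; rewrite -EFinD /m addrC subrK.
  - by move=> t _; rewrite lee_fin lowered_ge0.
  - by apply: measurable_EFin_nonincr; [exact: lowered_nonincr| |exact: subset_itvoc_pos].
  - by move=> t /itv_pos t0; rewrite lee_fin m0.
  - by apply: measurable_EFin_nonincr => //; exact: subset_itvoc_pos.
have mx : m x <= cumul m x / x by rewrite ler_pdivlMr// mulrC.
by rewrite e mulrDl; move: mx; rewrite {1}/m; lra.
Qed.

End lowered.

(** The integral of [phi^p] may be infinite, so [d] tends to 0 on a fixed []a, b]], where [phi] is
    bounded by [phi a]. The pointwise bound is assumed for all [u] and [g] because it is applied to
    [lowered phi d] and its mean. *)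
Lemma cumul_upper (R : realType) (p K l : R) (phi : R -> R) :
  let h x := cumul phi x / x in
  1 < p -> 0 <= K -> 0 <= l ->
  nonincr phi -> (forall t, 0 < t -> 0 <= phi t) -> near0_integrable phi ->
  (forall d, 0 < d -> exists2 N, 0 < N & forall t, N <= t -> phi t <= d) ->
  (forall u g, 0 <= u -> 0 <= g ->
     u `^ p + l * ((p - 1) * (u + g) `^ p) <=
     K * g `^ p + l * (p * (u + g) `^ (p - 1) * u)) ->
  (\int[lebesgue_measure]_(t in `]0%R, +oo[) (phi t `^ p)%:E <=
   K%:E * \int[lebesgue_measure]_(t in `]0%R, +oo[) ((h t - phi t) `^ p)%:E)%E.
Proof.
move=> h p1 K0 l0 nphi p0 fin van H.
have m : is_mean phi h := is_mean_cumul nphi p0 fin.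
apply: integral_pos_le.
- by apply/measurable_EFinP; apply: measurable_power_nonincr.
- by move=> t _; rewrite lee_fin powR_ge0.
move=> a b a0 ab; have b0 := lt_le_trans a0 ab.
apply/lee_addgt0Pr => e e0.
(* By the tangent inequality, [phi^p] exceeds the [p]-th power of [lowered phi d] by at most
   [p phi(a)^(p-1) d] on []a, b]]. The integrated loss is at most [C d], hence at most [e]. *)
pose C := p * phi a `^ (p - 1) * (b - a).
have C0 : 0 <= C.
  by rewrite !mulr_ge0 ?powR_ge0 ?subr_ge0// ltW// (lt_trans ltr01).
pose d := e / (C + 1).
have C10 : 0 < C + 1 by rewrite ltr_wpDl.
have d0 : 0 < d by rewrite divr_gt0.
have [N N0 phiN] := van d d0.
pose f := lowered phi d.
have nf : nonincr f by exact: lowered_nonincr.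
have f0 t : 0 <= f t by exact: lowered_ge0.
have ff : near0_integrable f by exact: lowered_near0 nphi p0 fin (ltW d0).
have mf : is_mean f (fun x => cumul f x / x) by apply: is_mean_cumul.
have fN t : N <= t -> f t = 0.
  by move=> Nt; rewrite /f /lowered max_r// subr_le0 phiN.
have Hf t : 0 < t ->
     f t `^ p + l * ((p - 1) * (cumul f t / t) `^ p) <=
     K * (cumul f t / t - f t) `^ p + l * (p * (cumul f t / t) `^ (p - 1) * f t).
  move=> t0; have [_ _ fh _] := mf.
  have := H (f t) (cumul f t / t - f t) (f0 t); rewrite subr_ge0 => /(_ (fh _ t0)).
  by rewrite (addrC (f t)) subrK.
have main := cumul_upper_support p1 K0 l0 N0 fN nf (fun t _ => f0 t) ff Hf.
have sub : `]a, b] `<=` (`]0, +oo[ : set R) by apply/subset_itvoc_pos/ltW.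
have posT (t : R) : `]0, +oo[%classic t -> 0 < t by rewrite /= in_itv/= andbT.
have step1 : (\int[lebesgue_measure]_(t in `]a, b]) (phi t `^ p)%:E <=
    \int[lebesgue_measure]_(t in `]a, b]) (f t `^ p)%:E + e%:E)%E.
  have mab : lebesgue_measure (`]a, b] : set R) = (b - a)%:E.
    rewrite lebesgue_measure_itv/= lte_fin; case: ltP => // ba.
    by rewrite (@le_anti _ _ a b) ?subrr// ab ba.
  have k0 : 0 <= p * phi a `^ (p - 1) * d.
    rewrite mulr_ge0 ?(ltW d0)// mulr_ge0 ?powR_ge0//.
    exact: ltW (lt_trans ltr01 p1).
  apply: (@le_trans _ _ (\int[lebesgue_measure]_(t in `]a, b])
      ((f t `^ p)%:E + (p * phi a `^ (p - 1) * d)%:E))%E).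
    apply: ge0_le_integral => //.
    - by move=> t _; rewrite lee_fin powR_ge0.
    - by apply/measurable_EFinP; apply: measurable_power_nonincr.
    - apply: emeasurable_funD => //.
      by apply/measurable_EFinP; apply: measurable_power_nonincr.
    - move=> t tab; have t0 := posT t (sub _ tab).
      rewrite -EFinD lee_fin.
      have := powR_convex_tangent p1 (f0 t) (p0 _ t0).
      have fd : phi t - d <= f t := le_lowered phi d t.
      have ta : phi t `^ (p - 1) <= phi a `^ (p - 1).
        move: tab; rewrite /= in_itv/= => /andP[a_t _].
        apply: ge0_ler_powR; rewrite ?nnegrE ?p0// ?subr_ge0 ?(ltW p1)//.
        by apply: nphi => //; exact: ltW.
      have pt0 := powR_ge0 (phi t) (p - 1).
      have P0 : 0 < p := lt_trans ltr01 p1.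
      have e1 : 0 <= p * phi t `^ (p - 1) by rewrite mulr_ge0// ltW.
      have e2 : p * phi t `^ (p - 1) * (- d) <= p * phi t `^ (p - 1) * (f t - phi t).
        by rewrite ler_wpM2l//; lra.
      have e3 : p * phi t `^ (p - 1) * d <= p * phi a `^ (p - 1) * d.
        by rewrite ler_wpM2r ?(ltW d0)// ler_wpM2l// ltW.
      lra.
  rewrite ge0_integralD//; last 2 first.
  - by move=> t _; rewrite lee_fin powR_ge0.
  - by apply/measurable_EFinP; apply: measurable_power_nonincr.
  rewrite leeD2l// integral_cst// -[X in (X <= _)%E]/(_ * lebesgue_measure _)%E mab.
  rewrite -EFinM lee_fin mulrAC -/C /d mulrA ler_pdivrMr// mulrC ler_pM2l//.
  by rewrite lerDl.
apply: le_trans step1 _; rewrite leeD2r//.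
apply: (@le_trans _ _ (\int[lebesgue_measure]_(t in `]0%R, +oo[) (f t `^ p)%:E)%E).
  apply: ge0_subset_integral => //.
  - by apply/measurable_EFinP; apply: measurable_power_nonincr.
  - by move=> t _; rewrite lee_fin powR_ge0.
apply: le_trans main _; apply: lee_wpmul2l; first by rewrite lee_fin.
apply: ge0_le_integral => //.
- by move=> t _; rewrite lee_fin powR_ge0.
- by apply/measurable_EFinP; apply: measurable_defect mf _ _.
- by apply/measurable_EFinP; apply: measurable_defect m _ _.
- move=> t /posT t0; rewrite lee_fin; have [_ _ fh _] := mf; have [_ _ ph _] := m.
  apply: ge0_ler_powR; rewrite ?nnegrE ?subr_ge0 ?fh ?ph//.
    by rewrite ltW// (lt_trans ltr01).
  exact: lowered_defect nphi p0 fin (ltW d0) _ t0.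
Qed.

(** * From integrals to norms *)

Lemma nonincreasing_vanishing_facts (R : realType) (phi : R -> R) :
  nonincreasing_vanishing phi ->
  [/\ nonincr phi, (forall t, 0 < t -> 0 <= phi t)
    & forall d, 0 < d -> exists2 N, 0 < N & forall t, N <= t -> phi t <= d].
Proof.
case=> ni p0 cv; split => //.
  move=> x y x0 xy; apply: ni => //; rewrite in_itv/= andbT//.
  exact: lt_le_trans xy.
move=> d d0; move/cvgrPdist_le : cv => /(_ d d0) [M [_ HM]].
(* The limit controls only [t > M], with [M] of any sign: the maximum with 0 makes the threshold
   positive, the added 1 makes it exceed [M]. *)
exists (Num.max M 0 + 1); first by rewrite ltr_wpDl// le_max lexx orbT.
move=> t Mt; have : M < t.
  by apply: lt_le_trans Mt; rewrite ltr_pwDr// le_max lexx.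
move=> /HM /=; rewrite sub0r normrN => h; exact: le_trans (ler_norm _) h.
Qed.

(** As [p] is nonzero, the [p]-th power of the extension by 0 vanishes outside []0, +oo[]. *)
Lemma halfline_LnormE (R : realType) (p : R) (g : R -> \bar R) : p != 0 ->
  (halfline_Lnorm p g =
   poweR (\int[lebesgue_measure]_(t in `]0%R, +oo[) poweR `|g t| p) p^-1)%E.
Proof.
move=> p0; rewrite /halfline_Lnorm unlock; congr poweR.
rewrite [RHS]integral_mkcond; apply: eq_integral => x _.
rewrite !patchE; case: ifPn => // _.
by rewrite abse0 poweR0r.
Qed.

Lemma halfline_Lnorm_EFin (R : realType) (p : R) (g : R -> \bar R) (f : R -> R) :
  p != 0 -> (forall t, 0 < t -> g t = (f t)%:E) -> (forall t, 0 < t -> 0 <= f t) ->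
  (halfline_Lnorm p g =
   poweR (\int[lebesgue_measure]_(t in `]0%R, +oo[) (f t `^ p)%:E) p^-1)%E.
Proof.
move=> p0 gf f0; rewrite halfline_LnormE//; congr poweR.
apply: eq_integral => t; rewrite inE/= in_itv/= andbT => t0.
by rewrite gf// abse_EFin ger0_norm ?f0.
Qed.

Lemma halfline_Lnorm_pinfty (R : realType) (p : R) (g : R -> \bar R) :
  0 < p -> (forall t, 0 < t -> g t = +oo%E) -> halfline_Lnorm p g = +oo%E.
Proof.
move=> p0 gy; rewrite halfline_LnormE ?gt_eqF//.
rewrite (_ : (\int[_]_(_ in _) _)%E = +oo%E) ?poweRyr ?invr_eq0 ?gt_eqF//.
rewrite (eq_integral (cst +oo%E)); last first.
  move=> t; rewrite inE/= in_itv/= andbT => t0.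
  by rewrite gy//= gt_eqF.
rewrite integral_cst// -[X in (X = _)%E]/(_ * lebesgue_measure _)%E.
by rewrite lebesgue_measure_itv/= ltry mulyy.
Qed.

Lemma poweR_root_le (R : realType) (p K : R) (I J : \bar R) :
  0 < p -> 0 <= K -> (0 <= I)%E -> (K%:E * I <= J)%E ->
  ((K `^ p^-1)%:E * poweR I p^-1 <= poweR J p^-1)%E.
Proof.
move=> p0 K0 I0 KIJ; rewrite -poweR_EFin -poweRM ?lee_fin//.
have KI0 : (0 <= K%:E * I)%E by rewrite mule_ge0.
apply: gt0_ler_poweR => //; rewrite ?invr_ge0 ?(ltW p0)//.
  by rewrite in_itv/= KI0 leey.
by rewrite in_itv/= (le_trans KI0)// leey.
Qed.

Lemma poweR_root_ge (R : realType) (p K : R) (I J : \bar R) :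
  0 < p -> 0 <= K -> (0 <= I)%E -> (0 <= J)%E -> (J <= K%:E * I)%E ->
  (poweR J p^-1 <= (K `^ p^-1)%:E * poweR I p^-1)%E.
Proof.
move=> p0 K0 I0 J0 KIJ; rewrite -poweR_EFin -poweRM ?lee_fin//.
apply: gt0_ler_poweR => //; rewrite ?invr_ge0 ?(ltW p0)//.
  by rewrite in_itv/= J0 leey.
by rewrite in_itv/= (le_trans J0)// leey.
Qed.

Section norm_inequalities.
Variables (R : realType) (p K l : R) (phi : R -> R).
Hypotheses (p1 : 1 < p) (K0 : 0 <= K).
Hypotheses (nphi : nonincr phi) (p0 : forall t : R, 0 < t -> 0 <= phi t).

Let h x := cumul phi x / x.
Let P0 : 0 < p. Proof. exact: lt_trans p1. Qed.
Let I := (\int[lebesgue_measure]_(t in `]0%R, +oo[) ((h t - phi t) `^ p)%:E)%E.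
Let J := (\int[lebesgue_measure]_(t in `]0%R, +oo[) (phi t `^ p)%:E)%E.
Let I0 : (0 <= I)%E.
Proof. by apply: integral_ge0 => t _; rewrite lee_fin powR_ge0. Qed.
Let J0 : (0 <= J)%E.
Proof. by apply: integral_ge0 => t _; rewrite lee_fin powR_ge0. Qed.

Lemma halfline_Lnorm_phi : halfline_Lnorm p (EFin \o phi) = poweR J p^-1.
Proof. by apply: halfline_Lnorm_EFin; rewrite ?gt_eqF. Qed.

Lemma halfline_Lnorm_hardy_sub : near0_integrable phi ->
  halfline_Lnorm p (hardy_sub phi) = poweR I p^-1.
Proof.
move=> fin; apply: halfline_Lnorm_EFin; rewrite ?gt_eqF// => t t0.
  exact: hardy_sub_cumul.
by rewrite subr_ge0; have [_ _ + _] := is_mean_cumul nphi p0 fin; apply.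
Qed.

(** An infinite norm of [phi] makes the claim trivial; a finite one yields integrability near 0, and
    only then is [phi <= h] available. Hence the premise in the pointwise hypothesis. *)
Lemma norm_lower : 0 <= l <= 1 ->
  (forall t, 0 < t -> phi t <= h t ->
     K * (h t - phi t) `^ p + l * (p * h t `^ (p - 1) * phi t) <=
     phi t `^ p + l * ((p - 1) * h t `^ p)) ->
  ((K `^ p^-1)%:E * halfline_Lnorm p (hardy_sub phi) <=
   halfline_Lnorm p (EFin \o phi))%E.
Proof.
move=> l01 H; rewrite halfline_Lnorm_phi.
have [Jfin|] := ltP J +oo%E; last first.
  by rewrite leye_eq => /eqP ->; rewrite poweRyr ?leey// invr_eq0 gt_eqF.
have fin := near0_integrable_power p1 nphi p0 Jfin.
rewrite halfline_Lnorm_hardy_sub//; apply: poweR_root_le => //.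
apply: (cumul_lower p1 K0 l01 nphi p0 fin) => t t0; apply: H => //.
by have [_ _ + _] := is_mean_cumul nphi p0 fin; apply.
Qed.

(** If [phi] is not integrable near 0, then [H phi - phi] is infinite everywhere and, as [K > 0], so
    is the right-hand side. *)
Lemma norm_upper : 0 < K -> 0 <= l ->
  (forall d, 0 < d -> exists2 N, 0 < N & forall t, N <= t -> phi t <= d) ->
  (forall u g, 0 <= u -> 0 <= g ->
     u `^ p + l * ((p - 1) * (u + g) `^ p) <=
     K * g `^ p + l * (p * (u + g) `^ (p - 1) * u)) ->
  (halfline_Lnorm p (EFin \o phi) <=
   (K `^ p^-1)%:E * halfline_Lnorm p (hardy_sub phi))%E.
Proof.
move=> Kpos l0 van H; have [fin|nfin] := pselect (near0_integrable phi).
  rewrite halfline_Lnorm_phi halfline_Lnorm_hardy_sub//.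
  by apply: poweR_root_ge => //; exact: (cumul_upper p1 K0 l0 nphi p0 fin van H).
rewrite (@halfline_Lnorm_pinfty _ _ (hardy_sub phi))//.
  by rewrite gt0_muley ?leey// lte_fin powR_gt0.
exact: not_near0_integrable.
Qed.

(** The pointwise bound is required only along [phi]; for the indicator it holds there in this
    direction for every [p > 1]. *)
Lemma norm_upper_support (N : R) : 0 <= l -> 0 < N ->
  (forall t, N <= t -> phi t = 0) -> near0_integrable phi ->
  (forall t, 0 < t ->
     phi t `^ p + l * ((p - 1) * h t `^ p) <=
     K * (h t - phi t) `^ p + l * (p * h t `^ (p - 1) * phi t)) ->
  (halfline_Lnorm p (EFin \o phi) <=
   (K `^ p^-1)%:E * halfline_Lnorm p (hardy_sub phi))%E.
Proof.
move=> l0 N0 phiN fin H.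
rewrite halfline_Lnorm_phi halfline_Lnorm_hardy_sub//.
by apply: poweR_root_ge => //; apply: (cumul_upper_support p1 K0 l0 N0).
Qed.

End norm_inequalities.

(** * Integrals of powers *)

(** Concavity of [t ^ s / s]. Negative [s] occurs for the integrable tails [t ^ (s - 1)] at
    infinity; there Bernoulli's inequality with exponent [1 - s] is applied at [1 / t] and
    multiplied by [t]. *)
Lemma powR_slope_at1 (R : realType) (s t : R) :
  s != 0 -> s <= 1 -> 0 < t -> (t `^ s - 1) / s <= t - 1.
Proof.
move=> sne s1 t0; case: (ltgtP s 0) sne => // sg _.
  rewrite ler_ndivrMr//.
  have u0 : 0 <= t^-1 by rewrite invr_ge0 ltW.
  have := @powR_ge_line R (1 - s) t^-1 (_ : 1 <= 1 - s) u0.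
  have -> : t^-1 `^ (1 - s) = t `^ s / t.
    rewrite -[in LHS]powR_inv1 ?(ltW t0)// -powRrM mulN1r opprB powRB.
      by rewrite powRr1 ?(ltW t0).
    by rewrite (gt_eqF t0) implybT.
  move=> /(_ ltac:(lra)) /(ler_wpM2r (ltW t0)).
  rewrite divfK ?gt_eqF// (_ : (1 + _) * t = 1 + s * (t - 1)); first by lra.
  by field; rewrite gt_eqF.
rewrite ler_pdivrMr//; have := @powR_le_line R s t.
by rewrite (ltW sg) s1 => /(_ isT (ltW t0)); lra.
Qed.

Lemma powR_slope (R : realType) (s x y : R) :
  s != 0 -> s <= 1 -> 0 < x -> 0 < y ->
  (y `^ s - x `^ s) / s <= (y - x) * x `^ (s - 1).
Proof.
move=> sne s1 x0 y0.
have xs : x `^ s = x * x `^ (s - 1).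
  rewrite powRB; last by rewrite (gt_eqF x0) implybT.
  by rewrite powRr1 ?(ltW x0)// mulrC divfK// gt_eqF.
have ys : y `^ s = x `^ s * (y / x) `^ s.
  by rewrite -powRM ?divr_ge0 ?ltW// mulrC divfK// gt_eqF.
have := @powR_slope_at1 R s (y / x) sne s1 (divr_gt0 y0 x0).
move=> /(ler_wpM2l (powR_ge0 x s)); rewrite ys.
have -> : x `^ s * (y / x - 1) = (y - x) * x `^ (s - 1).
  by rewrite xs; field; rewrite gt_eqF.
by apply: le_trans; rewrite mulrA mulrBr mulr1.
Qed.

Lemma powR_nonincr (R : realType) (r : R) : r <= 0 -> nonincr (fun t => t `^ r).
Proof.
move=> r0 x y x0 xy; have y0 := lt_le_trans x0 xy.
rewrite -(opprK r) !(powRN _ (- r)) lef_pV2 ?posrE ?powR_gt0//.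
by apply: ge0_ler_powR; rewrite ?nnegrE ?oppr_ge0 ?(ltW x0) ?(ltW y0).
Qed.

Lemma integral_powR (R : realType) (s a b : R) :
  s != 0 -> s <= 1 -> 0 < a -> a <= b ->
  (\int[lebesgue_measure]_(t in `]a, b]) (t `^ (s - 1))%:E =
   ((b `^ s - a `^ s) / s)%:E)%E.
Proof.
move=> sne s1 a0 ab.
have nA : nonincr (fun t => t `^ (s - 1)) by apply: powR_nonincr; lra.
have := @integral_nonincr_increments R (fun t => t `^ (s - 1)) (cst 0)
  (fun t => t `^ s / s) a b nA (fun x y _ _ => lexx _)
  (fun t _ => powR_ge0 _ _) (fun t _ => lexx _) _ a0 ab.
have [v ve _] := integral_nonincr_bounds nA (fun t _ => powR_ge0 _ _) a0 ab.
rewrite /cst integral0 add0e ve => H; congr EFin.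
suff : v + a `^ s / s = b `^ s / s by rewrite mulrBl; lra.
apply: EFin_inj; rewrite EFinD; apply: H => x y x0 xy; rewrite !subr0.
have y0 := lt_le_trans x0 xy.
have := powR_slope sne s1 x0 y0; have := powR_slope sne s1 y0 x0.
by rewrite !mulrBl => h1 h2; apply/andP; split; lra.
Qed.

(** The test functions change their formula at 1, so the two sides are estimated separately. *)
Lemma integral_pos_le_split (R : realType) (f : R -> R) (C1 C2 : R) :
  nonincr f -> (forall t, 0 < t -> 0 <= f t) ->
  (forall a, 0 < a -> a <= 1 ->
     (\int[lebesgue_measure]_(t in `]a, 1%R]) (f t)%:E <= C1%:E)%E) ->
  (forall b, 1 <= b ->
     (\int[lebesgue_measure]_(t in `]1%R, b]) (f t)%:E <= C2%:E)%E) ->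
  (\int[lebesgue_measure]_(t in `]0%R, +oo[) (f t)%:E <= (C1 + C2)%:E)%E.
Proof.
move=> nf f0 H1 H2; apply: integral_pos_le.
- by apply: measurable_EFin_nonincr.
- by move=> t t0; rewrite lee_fin f0.
move=> a b a0 ab.
pose a' := Num.min a 1; pose b' := Num.max b 1.
have a'0 : 0 < a' by rewrite lt_min a0 ltr01.
have a'1 : a' <= 1 by rewrite ge_min lexx orbT.
have b'1 : 1 <= b' by rewrite le_max lexx orbT.
apply: (@le_trans _ _ (\int[lebesgue_measure]_(t in `]a', b']) (f t)%:E)%E).
  apply: ge0_subset_integral => //.
  - by apply: measurable_EFin_nonincr => //; exact/subset_itvoc_pos/ltW.
  - move=> t /=; rewrite in_itv/= => /andP[at' _]; rewrite lee_fin f0//.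
    exact: lt_trans at'.
  - move=> t /=; rewrite !in_itv/= => /andP[at' tb].
    by rewrite gt_min at' le_max tb.
rewrite (integral_itvoc_cat a'1 b'1); last 2 first.
- by apply: measurable_EFin_nonincr => //; exact/subset_itvoc_pos/ltW.
- by move=> t a't; rewrite lee_fin f0// (lt_trans a'0).
by rewrite EFinD; apply: leeD; [exact: H1|exact: H2].
Qed.

Lemma integral_pos_ge1 (R : realType) (f : R -> R) :
  nonincr f -> (forall t, 0 < t -> 0 <= f t) ->
  (forall t, 0 < t -> t <= 1 -> 1 <= f t) ->
  (1 <= \int[lebesgue_measure]_(t in `]0%R, +oo[) (f t)%:E)%E.
Proof.
move=> nf f0 f1.
have m1 : lebesgue_measure (`]0, 1] : set R) = 1%E.
  by rewrite lebesgue_measure_itv/= lte_fin ltr01 oppr0 adde0.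
rewrite -[X in (X <= _)%E]mul1e -[X in (_ * X <= _)%E]m1 -integral_cst//.
apply: (@le_trans _ _ (\int[lebesgue_measure]_(t in `]0%R, 1%R]) (f t)%:E)%E).
  apply: ge0_le_integral => //.
  - by apply: measurable_EFin_nonincr => //; exact: subset_itvoc_pos.
  - by move=> t /=; rewrite in_itv/= lee_fin => /andP[t0 t1]; exact: f1.
apply: ge0_subset_integral => //.
- exact: measurable_EFin_nonincr.
- by move=> t /=; rewrite in_itv/= andbT => t0; rewrite lee_fin f0.
- exact: subset_itvoc_pos.
Qed.

Lemma nonincreasing_vanishingI (R : realType) (phi : R -> R) :
  nonincr phi -> (forall t, 0 < t -> 0 <= phi t) ->
  (forall d, 0 < d -> exists2 N, 0 < N & forall t, N <= t -> phi t <= d) ->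
  nonincreasing_vanishing phi.
Proof.
move=> nphi p0 van; split => //.
  by move=> x y x0 _ xy; apply: nphi => //; move: x0; rewrite in_itv/= andbT.
apply/cvgrPdist_le => d d0; have [N N0 HN] := van d d0.
exists N; split; first exact: num_real.
move=> t /= Nt; have t0 := lt_trans N0 Nt.
by rewrite sub0r normrN ger0_norm ?p0// HN// ltW.
Qed.

(** * Refuting a constant by a test function *)

Section norm_vs_defect.
Variables (R : realType) (p : R) (phi : R -> R).
Hypotheses (p1 : 1 < p) (nphi : nonincr phi).
Hypotheses (p0 : forall t : R, 0 < t -> 0 <= phi t).
Hypothesis J1 : forall t : R, 0 < t -> t <= 1 -> 1 <= phi t.
Hypothesis Jfin :
  (\int[lebesgue_measure]_(t in `]0%R, +oo[) (phi t `^ p)%:E < +oo)%E.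

Let h x := cumul phi x / x.
Let fin : near0_integrable phi. Proof. exact: near0_integrable_power Jfin. Qed.
Let m : is_mean phi h. Proof. exact: is_mean_cumul. Qed.
Let P0 : 0 < p. Proof. exact: lt_trans p1. Qed.

Let root_pow (c : R) : 0 <= c -> (c `^ p) `^ p^-1 = c.
Proof. by move=> c0; rewrite -powRrM mulfV ?gt_eqF// powRr1. Qed.

(** A positive finite norm can be cancelled, so a ratio of norms decides whether a constant is
    admissible. *)
Lemma halfline_Lnorm_fin : exists2 r, 0 < r & halfline_Lnorm p (EFin \o phi) = r%:E.
Proof.
have : (1 <= \int[lebesgue_measure]_(t in `]0%R, +oo[) (phi t `^ p)%:E)%E.
  apply: integral_pos_ge1 => [x y x0 xy|t _|t t0 t1].
  - by apply: ge0_ler_powR; rewrite ?nnegrE ?p0 ?(ltW P0) ?nphi// (lt_le_trans x0).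
  - by rewrite powR_ge0.
  - have := J1 t0 t1 => h1.
    have := @ge0_ler_powR R p (ltW P0) 1 (phi t).
    by rewrite powR1 !nnegrE ler01 p0//; apply.
rewrite halfline_Lnorm_phi//; move: Jfin.
case: (\int[_]_(_ in _) _)%E => // j _; rewrite lee_fin => j1.
by exists (j `^ p^-1) => //; rewrite powR_gt0// (lt_le_trans ltr01).
Qed.

Let integral_scale (c : R) : 0 <= c ->
  (\int[lebesgue_measure]_(t in `]0%R, +oo[) ((c * phi t) `^ p)%:E =
   (c `^ p)%:E * \int[lebesgue_measure]_(t in `]0%R, +oo[) (phi t `^ p)%:E)%E.
Proof.
move=> c0; rewrite -ge0_integralZl_EFin ?powR_ge0//.
- by apply: eq_integral => t; rewrite inE/= in_itv/= andbT => t0; rewrite powRM ?p0.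
- by move=> t _; rewrite lee_fin powR_ge0.
- by apply/measurable_EFinP; apply: measurable_power_nonincr.
Qed.

Let measurable_scale (c : R) :
  measurable_fun (`]0, +oo[ : set R) (fun t => ((c * phi t) `^ p)%:E).
Proof.
apply/measurable_EFinP; apply: (measurableT_comp (measurable_powR p)).
by apply: measurable_funM => //; apply: measurable_nonincr.
Qed.

Lemma norm_defect_ge (c : R) : 0 <= c ->
  (forall t, 0 < t -> c * phi t <= h t - phi t) ->
  (c%:E * halfline_Lnorm p (EFin \o phi) <= halfline_Lnorm p (hardy_sub phi))%E.
Proof.
move=> c0 H; rewrite halfline_Lnorm_phi// halfline_Lnorm_hardy_sub//.
rewrite -[X in (X%:E * _)%E](root_pow c0); apply: poweR_root_le => //.
- by rewrite powR_ge0.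
- by apply: integral_ge0 => t _; rewrite lee_fin powR_ge0.
- rewrite -integral_scale//; apply: ge0_le_integral => //.
  + by move=> t _; rewrite lee_fin powR_ge0.
  + exact: measurable_scale.
  + by apply/measurable_EFinP; apply: measurable_defect m _ _.
  + move=> t /=; rewrite in_itv/= andbT lee_fin => t0.
    have ct0 : 0 <= c * phi t by rewrite mulr_ge0 ?p0.
    apply: ge0_ler_powR; rewrite ?nnegrE ?(ltW P0)//; last exact: H.
    exact: le_trans ct0 (H t t0).
Qed.

Lemma norm_defect_le (c : R) : 0 <= c ->
  (forall t, 0 < t -> h t - phi t <= c * phi t) ->
  (halfline_Lnorm p (hardy_sub phi) <= c%:E * halfline_Lnorm p (EFin \o phi))%E.
Proof.
move=> c0 H; rewrite halfline_Lnorm_phi// halfline_Lnorm_hardy_sub//.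
rewrite -[X in (X%:E * _)%E](root_pow c0); apply: poweR_root_ge => //.
- by rewrite powR_ge0.
- by apply: integral_ge0 => t _; rewrite lee_fin powR_ge0.
- by apply: integral_ge0 => t _; rewrite lee_fin powR_ge0.
- rewrite -integral_scale//; apply: ge0_le_integral => //.
  + by move=> t _; rewrite lee_fin powR_ge0.
  + by apply/measurable_EFinP; apply: measurable_defect m _ _.
  + exact: measurable_scale.
  + move=> t /=; rewrite in_itv/= andbT lee_fin => t0.
    have gt0 : 0 <= h t - phi t by rewrite subr_ge0; case: m => _ _ + _; apply.
    apply: ge0_ler_powR; rewrite ?nnegrE ?(ltW P0)//; last exact: H.
    exact: le_trans gt0 (H t t0).
Qed.

Lemma lower_constant_fails (C c : R) : 0 <= C -> 1 < C * c ->
  (c%:E * halfline_Lnorm p (EFin \o phi) <= halfline_Lnorm p (hardy_sub phi))%E ->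
  ~ (C%:E * halfline_Lnorm p (hardy_sub phi) <= halfline_Lnorm p (EFin \o phi))%E.
Proof.
move=> C0 Cc; have [r r0 ->] := halfline_Lnorm_fin.
move=> /(lee_wpmul2l (_ : (0 <= C%:E)%E)); rewrite lee_fin => /(_ C0).
move=> /le_trans h1 /h1; rewrite -!EFinM lee_fin mulrA; nra.
Qed.

Lemma upper_constant_fails (C c : R) : C * c < 1 ->
  (halfline_Lnorm p (hardy_sub phi) <= c%:E * halfline_Lnorm p (EFin \o phi))%E ->
  ~ (halfline_Lnorm p (EFin \o phi) <= C%:E * halfline_Lnorm p (hardy_sub phi))%E.
Proof.
move=> Cc; have [r r0 ->] := halfline_Lnorm_fin => h1 h2.
have N0 : (0 <= halfline_Lnorm p (hardy_sub phi))%E by exact: Lnorm_ge0.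
(* A negative [C] would make the positive norm of [phi] at most 0. *)
have [C0|C0] := leP 0 C; last first.
  have : (r%:E <= 0)%E by apply: le_trans h2 _; rewrite mule_le0_ge0// lee_fin ltW.
  by rewrite lee_fin leNgt r0.
have := le_trans h2 (lee_wpmul2l (_ : (0 <= C%:E)%E) h1).
by rewrite lee_fin => /(_ C0); rewrite -!EFinM lee_fin mulrA; nra.
Qed.

End norm_vs_defect.

(** * The test functions *)

(** The case [a = 0] is the indicator of []0, 1]]. Cutting to 0 beyond 1 keeps the defect at least
    [a / (1 - a)] times the function, as lower constants require. *)
Definition near0_power (R : realType) (a t : R) : R :=
  if t <= 1 then t `^ (- a) else 0.

(** Capping the singularity at 0 keeps the defect at most [a / (1 - a)] times the function, as upper
    constants require. *)
Definition infty_power (R : realType) (a t : R) : R :=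
  if t <= 1 then 1 else t `^ (- a).

Section power_families.
Variables (R : realType) (a : R).
Hypothesis a0 : 0 <= a.

Let powN_ge1 (t : R) : 0 < t -> t <= 1 -> 1 <= t `^ (- a).
Proof.
move=> t0 t1; have Na : - a <= 0 by rewrite oppr_le0.
by have := powR_nonincr Na t0 t1; rewrite powR1.
Qed.

Lemma near0_power_ge0 (t : R) : 0 <= near0_power a t.
Proof. by rewrite /near0_power; case: ifP => _; rewrite ?powR_ge0. Qed.

Lemma infty_power_ge0 (t : R) : 0 <= infty_power a t.
Proof. by rewrite /infty_power; case: ifP => _; rewrite ?powR_ge0. Qed.

Lemma near0_power_ge1 (t : R) : 0 < t -> t <= 1 -> 1 <= near0_power a t.
Proof. by move=> t0 t1; rewrite /near0_power t1 powN_ge1. Qed.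

Lemma near0_power_nonincr : nonincr (near0_power a).
Proof.
move=> x y x0 xy; rewrite /near0_power.
case: (leP y 1) => [y1|_]; last by case: ifP => _; rewrite ?powR_ge0.
by rewrite (le_trans xy y1) powR_nonincr// oppr_le0.
Qed.

Lemma infty_power_nonincr : nonincr (infty_power a).
Proof.
move=> x y x0 xy; rewrite /infty_power.
have Na : - a <= 0 by rewrite oppr_le0.
case: (leP x 1) => [x1|x1].
  case: (leP y 1) => [//|y1].
  by have := powR_nonincr Na ltr01 (ltW y1); rewrite powR1.
rewrite ifF ?powR_nonincr//.
by apply/negbTE; rewrite -ltNge (lt_le_trans x1 xy).
Qed.

Lemma near0_power_eq0 (t : R) : 2 <= t -> near0_power a t = 0.
Proof. by move=> t2; rewrite /near0_power ifF//; apply/negbTE; rewrite -ltNge; lra. Qed.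

Lemma near0_power_vanishing : nonincreasing_vanishing (near0_power a).
Proof.
apply: nonincreasing_vanishingI; first exact: near0_power_nonincr.
  by move=> t _; exact: near0_power_ge0.
by move=> d d0; exists 2 => // t t2; rewrite near0_power_eq0// ltW.
Qed.

Lemma infty_power_vanishing : 0 < a -> nonincreasing_vanishing (infty_power a).
Proof.
move=> apos; apply: nonincreasing_vanishingI; first exact: infty_power_nonincr.
  by move=> t _; exact: infty_power_ge0.
(* [z] solves [z ^ (- a) = d]; the 2 added below keeps [t] beyond 1, where the power formula
   applies. *)
move=> d d0; pose z := d `^ (- a^-1).
have z0 : 0 < z by rewrite powR_gt0.
exists (2 + z) => [|t zt]; first by rewrite addr_gt0.
rewrite /infty_power ifF; last by apply/negbTE; rewrite -ltNge; lra.
have Na : - a <= 0 by rewrite oppr_le0.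
have := powR_nonincr Na z0 (_ : z <= t) => /(_ ltac:(lra)) h.
apply: le_trans h _.
by rewrite /z -powRrM mulrNN mulVf ?gt_eqF// powRr1// ltW.
Qed.

Lemma near0_power_powR (p t : R) : 0 < p ->
  near0_power a t `^ p = near0_power (a * p) t.
Proof.
move=> p0; rewrite /near0_power; case: ifP => _; first by rewrite -powRrM mulNr.
by rewrite powR0// gt_eqF.
Qed.

Lemma infty_power_powR (p t : R) : infty_power a t `^ p = infty_power (a * p) t.
Proof.
rewrite /infty_power; case: ifP => _; last by rewrite -powRrM mulNr.
by rewrite powR1.
Qed.

Lemma integral_near0_power (x y : R) : 0 < x -> x <= y -> y <= 1 -> a < 1 ->
  (\int[lebesgue_measure]_(t in `]x, y]) (near0_power a t)%:E =
   ((y `^ (1 - a) - x `^ (1 - a)) / (1 - a))%:E)%E.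
Proof.
move=> x0 xy y1 a1; rewrite -integral_powR//; last 2 first.
- by rewrite subr_eq0 gt_eqF.
- by rewrite gerBl.
apply: eq_integral => t; rewrite inE/= in_itv/= => /andP[_ ty].
by rewrite /near0_power (le_trans ty y1) (_ : 1 - a - 1 = - a)//; ring.
Qed.

Lemma integral_infty_power (x y : R) : 1 <= x -> x <= y -> a != 1 ->
  (\int[lebesgue_measure]_(t in `]x, y]) (infty_power a t)%:E =
   ((y `^ (1 - a) - x `^ (1 - a)) / (1 - a))%:E)%E.
Proof.
move=> x1 xy a1; rewrite -integral_powR//; last 3 first.
- by rewrite subr_eq0 eq_sym.
- by rewrite gerBl.
- exact: lt_le_trans x1.
apply: eq_integral => t; rewrite inE/= in_itv/= => /andP[xt _].
rewrite /infty_power ifF; first by rewrite (_ : 1 - a - 1 = - a)//; ring.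
by apply/negbTE; rewrite -ltNge (le_lt_trans x1).
Qed.

Lemma integral_pos_near0_power : a < 1 ->
  (\int[lebesgue_measure]_(t in `]0%R, +oo[) (near0_power a t)%:E < +oo)%E.
Proof.
move=> a1; apply: le_lt_trans (ltry ((1 - a)^-1 + 0)).
apply: integral_pos_le_split.
- exact: near0_power_nonincr.
- by move=> t _; exact: near0_power_ge0.
- move=> x x0 x1; rewrite integral_near0_power// lee_fin powR1.
  by rewrite ler_pdivrMr ?subr_gt0// mulVf ?gt_eqF ?subr_gt0// gerBl powR_ge0.
- move=> y y1; rewrite (eq_integral (cst 0%E)) ?integral0// => t.
  rewrite inE/= in_itv/= => /andP[t1 _].
  by rewrite /near0_power ifF//; apply/negbTE; rewrite -ltNge.
Qed.

Lemma infty_power_le1 (x : R) : 0 <= x -> x <= 1 ->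
  (\int[lebesgue_measure]_(t in `]x, 1%R]) (infty_power a t)%:E = (1 - x)%:E)%E.
Proof.
move=> x0 x1.
have m : lebesgue_measure (`]x, 1] : set R) = (1 - x)%:E.
  rewrite lebesgue_measure_itv/= lte_fin; case: ltP => // h.
  by rewrite (@le_anti _ _ x 1) ?subrr// x1 h.
rewrite -m -[RHS]mul1e -integral_cst//; apply: eq_integral => t.
by rewrite inE/= in_itv/= => /andP[_ t1]; rewrite /infty_power t1.
Qed.

Lemma integral_pos_infty_power : 1 < a ->
  (\int[lebesgue_measure]_(t in `]0%R, +oo[) (infty_power a t)%:E < +oo)%E.
Proof.
move=> a1; apply: le_lt_trans (ltry (1 + (a - 1)^-1)).
apply: integral_pos_le_split.
- exact: infty_power_nonincr.
- by move=> t _; exact: infty_power_ge0.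
- by move=> x x0 x1; rewrite (infty_power_le1 (ltW x0) x1) lee_fin gerBl ltW.
- move=> y y1; rewrite integral_infty_power ?gt_eqF// lee_fin powR1.
  have -> : (y `^ (1 - a) - 1) / (1 - a) = (1 - y `^ (1 - a)) / (a - 1).
    by field; rewrite !subr_eq0 gt_eqF ?lt_eqF.
  by rewrite ler_pdivrMr ?subr_gt0// mulVf ?gt_eqF ?subr_gt0// gerBl powR_ge0.
Qed.

(* [cumul (near0_power a) x = x ^ (1 - a) / (1 - a)] for [x <= 1]; only the
   lower bound is needed. *)
Lemma near0_power_defect (x : R) : a < 1 -> 0 < x ->
  a / (1 - a) * near0_power a x <= cumul (near0_power a) x / x - near0_power a x.
Proof.
move=> a1 x0; have s0 : 0 < 1 - a by rewrite subr_gt0.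
have nphi := near0_power_nonincr.
have p0 t : 0 < t -> 0 <= near0_power a t by move=> _; exact: near0_power_ge0.
have fin : near0_integrable (near0_power a).
  move=> y y0; apply: le_lt_trans (integral_pos_near0_power a1).
  apply: ge0_subset_integral => //.
  - exact: measurable_EFin_nonincr.
  - by move=> t _; rewrite lee_fin near0_power_ge0.
  - exact: subset_itvoc_pos.
have [x1|x1] := leP x 1; last first.
  have -> : near0_power a x = 0 by rewrite /near0_power leNgt x1.
  by rewrite mulr0 subr0 divr_ge0 ?(ltW x0)// fine_ge0// integral_itv0_ge0.
have low : x `^ (1 - a) / (1 - a) <= cumul (near0_power a) x.
  apply/ler_addgt0Pr => e e0.
  have se0 : 0 < (1 - a) * e by rewrite mulr_gt0.
  (* Starting at [y] instead of 0 loses [y ^ (1 - a) / (1 - a)], which this choice makes at most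
     [e]. *)
  pose y := Num.min x (((1 - a) * e) `^ (1 - a)^-1).
  have y0 : 0 < y by rewrite lt_min x0 powR_gt0.
  have yx : y <= x by rewrite ge_min lexx.
  have ye : y `^ (1 - a) <= (1 - a) * e.
    have -> : (1 - a) * e = (((1 - a) * e) `^ (1 - a)^-1) `^ (1 - a).
      by rewrite -powRrM mulVf ?gt_eqF// powRr1// ltW.
    by apply: ge0_ler_powR; rewrite ?nnegrE ?powR_ge0 ?(ltW s0) ?(ltW y0)// ge_min lexx orbT.
  have := integral_itv0_cat nphi p0 y0 yx.
  rewrite !cumulE// integral_near0_power// -EFinD => -[->].
  have cy0 : 0 <= cumul (near0_power a) y by rewrite fine_ge0// integral_itv0_ge0.
  rewrite mulrBl.
  have : y `^ (1 - a) / (1 - a) <= e by rewrite ler_pdivrMr// mulrC.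
  lra.
have pE : near0_power a x = x `^ (1 - a) / x.
  rewrite /near0_power x1.
  have -> : x `^ (- a) = x `^ ((1 - a) - 1) by congr (_ `^ _); ring.
  rewrite -[X in _ = X / x](@mulr_powRB1 _ x (1 - a)) ?(ltW x0)//.
  by rewrite mulrAC mulfV ?mul1r// gt_eqF.
have : x `^ (1 - a) / (1 - a) / x <= cumul (near0_power a) x / x.
  by rewrite ler_wpM2r// invr_ge0 ltW.
have -> : x `^ (1 - a) / (1 - a) / x = near0_power a x * (1 + a / (1 - a)).
  by rewrite pE; field; rewrite !gt_eqF.
lra.
Qed.

(** For [x >= 1] the primitive is [x ^ (1 - a) / (1 - a) - a / (1 - a)], and the subtracted constant
    has the favourable sign. For [x <= 1] the mean is 1. *)
Lemma infty_power_defect (x : R) : a < 1 -> 0 < x ->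
  cumul (infty_power a) x / x - infty_power a x <= a / (1 - a) * infty_power a x.
Proof.
move=> a1 x0; have s0 : 0 < 1 - a by rewrite subr_gt0.
have nphi := infty_power_nonincr.
have p0 t : 0 < t -> 0 <= infty_power a t by move=> _; exact: infty_power_ge0.
have c1 : 0 <= a / (1 - a) by rewrite divr_ge0// ltW.
have cum1 : (\int[lebesgue_measure]_(t in `]0%R, 1%R]) (infty_power a t)%:E = 1)%E.
  by rewrite infty_power_le1// subr0.
have [x1|/ltW x1] := leP x 1.
  rewrite {2 3}/infty_power x1 mulr1 lerBlDr; apply: ler_wpDl => //.
  have := integral_itv0_cat nphi p0 x0 x1.
  rewrite cum1 infty_power_le1 ?(ltW x0)// /cumul.
  case: (\int[_]_(_ in _) _)%E => [r||]//= [e].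
  rewrite ler_pdivrMr// mul1r; lra.
have := integral_itv0_cat nphi p0 ltr01 x1.
rewrite cum1 integral_infty_power ?lt_eqF// /cumul => ->.
rewrite powR1 -EFinD /=.
have pE : infty_power a x = x `^ (1 - a) / x.
  rewrite /infty_power; case: ifP => [h|_].
    by rewrite (@le_anti _ _ x 1) ?powR1 ?divr1// h x1.
  have -> : x `^ (- a) = x `^ ((1 - a) - 1) by congr (_ `^ _); ring.
  rewrite -[X in _ = X / x](@mulr_powRB1 _ x (1 - a)) ?(ltW x0)//.
  by rewrite mulrAC mulfV ?mul1r// gt_eqF.
have -> : (1 + (x `^ (1 - a) - 1) / (1 - a)) / x =
    infty_power a x * (1 + a / (1 - a)) - a / (1 - a) / x.
  by rewrite pE; field; rewrite !gt_eqF.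
have : 0 <= a / (1 - a) / x by rewrite divr_ge0// ltW.
lra.
Qed.

End power_families.

(** * Optimality of the constants *)

Section indicator.
Variables (R : realType) (p : R).
Hypothesis p1 : 1 < p.

Let phi : R -> R := near0_power 0.
Let h x := cumul phi x / x.

Let phi1 (t : R) : t <= 1 -> phi t = 1.
Proof. by move=> t1; rewrite /phi /near0_power t1 oppr0 powRr0. Qed.

Let indicator_cases (t : R) : 0 < t -> phi t = 0 \/ phi t = h t.
Proof.
move=> t0; have [t1|t1] := leP t 1; last first.
  by left; rewrite /phi /near0_power leNgt t1.
right; rewrite /h /cumul phi1//.
have m : lebesgue_measure (`]0, t] : set R) = t%:E.
  by rewrite lebesgue_measure_itv/= lte_fin t0 oppr0 adde0.
rewrite (_ : (\int[_]_(_ in _) _)%E = t%:E) /= ?divff ?gt_eqF//.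
rewrite -[RHS]mul1e -[in RHS]m -integral_cst//; apply: eq_integral => s.
by rewrite inE/= in_itv/= => /andP[_ st]; rewrite phi1// (le_trans st).
Qed.

(** At each point either [phi] or [h - phi] vanishes. Being an equality, this serves both
    directions, whatever [p > 1]. *)
Let pointwise_eq (t : R) : 0 < t ->
  (p - 1) * (h t - phi t) `^ p + 1 * (p * h t `^ (p - 1) * phi t) =
  phi t `^ p + 1 * ((p - 1) * h t `^ p).
Proof.
move=> t0; have pne : p != 0 by rewrite gt_eqF// (lt_trans ltr01).
have [->|e] := indicator_cases t0.
  by rewrite subr0 mulr0 powR0//; ring.
have h0 : 0 <= h t by rewrite -e /phi near0_power_ge0.
rewrite e subrr powR0// -(mulr_powRB1 h0 (lt_trans ltr01 p1)); ring.
Qed.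

Let nphi : nonincr phi. Proof. exact: near0_power_nonincr. Qed.
Let p0 (t : R) : 0 < t -> 0 <= phi t. Proof. by move=> _; exact: near0_power_ge0. Qed.
Let P0 : 0 < p. Proof. exact: lt_trans p1. Qed.
Let K0 : 0 <= p - 1. Proof. by rewrite subr_ge0 ltW. Qed.
Let J1 (t : R) : 0 < t -> t <= 1 -> 1 <= phi t.
Proof. by move=> _ t1; rewrite phi1. Qed.
Let Jfin : (\int[lebesgue_measure]_(t in `]0%R, +oo[) (phi t `^ p)%:E < +oo)%E.
Proof.
under eq_integral do rewrite near0_power_powR// mul0r.
exact: integral_pos_near0_power.
Qed.
Let k0 : 0 < (p - 1) `^ p^-1. Proof. by rewrite powR_gt0 // subr_gt0. Qed.

Lemma indicator_lower_sharp (C : R) : (p - 1) `^ p^-1 < C ->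
  ~ (C%:E * halfline_Lnorm p (hardy_sub phi) <= halfline_Lnorm p (EFin \o phi))%E.
Proof.
move=> Ck; apply: (@lower_constant_fails _ p phi p1 nphi p0 J1 Jfin C
  ((p - 1) `^ p^-1)^-1).
- exact: ltW (lt_trans k0 Ck).
- by rewrite ltr_pdivlMr// mul1r.
- rewrite lee_pdivrMl//.
  have fin := near0_integrable_power p1 nphi p0 Jfin.
  apply: (@norm_upper_support _ p (p - 1) 1 phi p1 K0 nphi p0 2) => //.
    by move=> t; exact: near0_power_eq0.
  by move=> t t0; rewrite -pointwise_eq.
Qed.

Lemma indicator_upper_sharp (C : R) : C < (p - 1) `^ p^-1 ->
  ~ (halfline_Lnorm p (EFin \o phi) <= C%:E * halfline_Lnorm p (hardy_sub phi))%E.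
Proof.
move=> Ck; apply: (@upper_constant_fails _ p phi p1 nphi p0 J1 Jfin C
  ((p - 1) `^ p^-1)^-1).
- by rewrite ltr_pdivrMr// mul1r.
- rewrite lee_pdivlMl//.
  apply: (@norm_lower _ p (p - 1) 1 phi p1 K0 nphi p0).
    by rewrite ler01 lexx.
  by move=> t t0 _; rewrite pointwise_eq.
Qed.

End indicator.

(* Midpoint of [1 / (1 + C)] and [1 / p]: then [C a / (1 - a) > 1] and [a p < 1]. *)
Lemma near0_power_sharp (R : realType) (p C : R) : 1 < p -> p - 1 < C ->
  exists2 a, 0 <= a &
  ~ (C%:E * halfline_Lnorm p (hardy_sub (near0_power a)) <=
     halfline_Lnorm p (EFin \o near0_power a))%E.
Proof.
move=> p1 Cp; have P0 : 0 < p by exact: lt_trans p1.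
have C0 : 0 < C by lra.
pose u := (1 + C)^-1; pose v := p^-1; pose a := (u + v) / 2.
have u0 : 0 < u by rewrite invr_gt0; lra.
have uv : u < v by rewrite ltf_pV2 ?posrE//; lra.
have v1 : v < 1 by rewrite invf_lt1.
have a0 : 0 <= a by rewrite /a; lra.
have a1 : a < 1 by rewrite /a; lra.
have ua : u < a by rewrite /a; lra.
have av : a < v by rewrite /a; lra.
have p0 t : 0 < t -> 0 <= near0_power a t by move=> _; exact: near0_power_ge0.
have ap : a * p < 1 by rewrite -ltr_pdivlMr// mul1r.
have Jfin : (\int[lebesgue_measure]_(t in `]0%R, +oo[) (near0_power a t `^ p)%:E < +oo)%E.
  under eq_integral do rewrite near0_power_powR//.
  by apply: integral_pos_near0_power => //; rewrite mulr_ge0// ltW.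
exists a => //; have s0 : 0 < 1 - a by rewrite subr_gt0.
apply: (@lower_constant_fails _ p _ p1 (near0_power_nonincr a0) p0
  (near0_power_ge1 a0) Jfin C (a / (1 - a)) (ltW C0)).
  rewrite mulrA ltr_pdivlMr//.
  have : 1 < a * (1 + C) by rewrite -ltr_pdivrMr ?div1r//; lra.
  lra.
apply: norm_defect_ge => //; first exact: near0_power_nonincr.
  by rewrite divr_ge0// ltW.
by move=> t t0; exact: near0_power_defect.
Qed.

(** Here [a] is the midpoint of [1 / p] and [1 / (1 + C')], so that [a p > 1] and
    [C' a / (1 - a) < 1]. Replacing [C] by [C' = max C 0] keeps [1 / (1 + C')] at most 1, hence
    [a < 1]. *)
Lemma infty_power_sharp (R : realType) (p C : R) : 1 < p -> C < p - 1 ->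
  exists2 a, 0 < a &
  ~ (halfline_Lnorm p (EFin \o infty_power a) <=
     C%:E * halfline_Lnorm p (hardy_sub (infty_power a)))%E.
Proof.
move=> p1 Cp; have P0 : 0 < p by exact: lt_trans p1.
pose C' := Num.max C 0.
have C'0 : 0 <= C' by rewrite le_max lexx orbT.
have CC' : C <= C' by rewrite le_max lexx.
have C'p : C' < p - 1 by rewrite gt_max Cp subr_gt0.
pose u := (1 + C')^-1; pose v := p^-1; pose a := (u + v) / 2.
have v0 : 0 < v by rewrite invr_gt0.
have uv : v < u by rewrite ltf_pV2 ?posrE//; lra.
have u1 : u <= 1 by rewrite invf_le1; lra.
have a0 : 0 < a by rewrite /a; lra.
have a1 : a < 1 by rewrite /a; lra.
have ua : a < u by rewrite /a; lra.
have av : v < a by rewrite /a; lra.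
have p0 t : 0 < t -> 0 <= infty_power a t by move=> _; exact: infty_power_ge0.
have ap : 1 < a * p by rewrite -ltr_pdivrMr// div1r.
have Jfin : (\int[lebesgue_measure]_(t in `]0%R, +oo[) (infty_power a t `^ p)%:E < +oo)%E.
  under eq_integral do rewrite infty_power_powR//.
  by apply: integral_pos_infty_power => //; rewrite mulr_ge0// ltW.
have s0 : 0 < 1 - a by rewrite subr_gt0.
have c0 : 0 <= a / (1 - a) by rewrite divr_ge0// ltW.
have ge1 t : 0 < t -> t <= 1 -> 1 <= infty_power a t.
  by move=> _ t1; rewrite /infty_power t1.
exists a => //.
apply: (@upper_constant_fails _ p _ p1 (infty_power_nonincr (ltW a0)) p0
  ge1 Jfin C (a / (1 - a))).
  apply: (@le_lt_trans _ _ (C' * (a / (1 - a)))); first by rewrite ler_wpM2r.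
  rewrite mulrA ltr_pdivrMr//.
  have : a * (1 + C') < 1 by rewrite -ltr_pdivlMr ?div1r//; lra.
  lra.
apply: norm_defect_le => //; first exact: infty_power_nonincr (ltW a0).
by move=> t t0; apply: infty_power_defect => //; exact: ltW.
Qed.

Theorem theorem1p2 (R : realType) (p : R) (hp : 1 < p) :
  (p <= 2 ->
    [/\ forall phi : R -> R, nonincreasing_vanishing phi ->
          ((p - 1)%:E * halfline_Lnorm p (hardy_sub phi)
             <= halfline_Lnorm p (EFin \o phi))%E /\
          (halfline_Lnorm p (EFin \o phi)
             <= ((p - 1) `^ p^-1)%:E * halfline_Lnorm p (hardy_sub phi))%E,
        forall C : R, p - 1 < C ->
          ~ (forall phi : R -> R, nonincreasing_vanishing phi ->
               (C%:E * halfline_Lnorm p (hardy_sub phi)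
                  <= halfline_Lnorm p (EFin \o phi))%E)
      & forall C : R, C < (p - 1) `^ p^-1 ->
          ~ (forall phi : R -> R, nonincreasing_vanishing phi ->
               (halfline_Lnorm p (EFin \o phi)
                  <= C%:E * halfline_Lnorm p (hardy_sub phi))%E)]) /\
  (2 <= p ->
    [/\ forall phi : R -> R, nonincreasing_vanishing phi ->
          (((p - 1) `^ p^-1)%:E * halfline_Lnorm p (hardy_sub phi)
             <= halfline_Lnorm p (EFin \o phi))%E /\
          (halfline_Lnorm p (EFin \o phi)
             <= (p - 1)%:E * halfline_Lnorm p (hardy_sub phi))%E,
        forall C : R, (p - 1) `^ p^-1 < C ->
          ~ (forall phi : R -> R, nonincreasing_vanishing phi ->
               (C%:E * halfline_Lnorm p (hardy_sub phi)
                  <= halfline_Lnorm p (EFin \o phi))%E)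
      & forall C : R, C < p - 1 ->
          ~ (forall phi : R -> R, nonincreasing_vanishing phi ->
               (halfline_Lnorm p (EFin \o phi)
                  <= C%:E * halfline_Lnorm p (hardy_sub phi))%E)]).

Proof.
have P0 : 0 < p by exact: lt_trans hp.
have s0 : 0 < p - 1 by rewrite subr_gt0.
have K0 : 0 < (p - 1) `^ p by rewrite powR_gt0.
have root : ((p - 1) `^ p) `^ p^-1 = p - 1.
  by rewrite -powRrM mulfV ?gt_eqF// powRr1// ltW.
split=> p2; split.
- move=> phi /nonincreasing_vanishing_facts[nphi p0 van].
  have sg : 0 <= 1 * (2 - p) by rewrite mul1r subr_ge0.
  split.
    rewrite -[X in (X%:E * _)%E]root.
    apply: (@norm_lower _ p _ (lam p) phi hp (ltW K0) nphi p0).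
      by rewrite lam_ge0// lam_le1.
    move=> t t0 ph.
    have := pointwise_power hp sg (p0 t t0) (_ : 0 <= cumul phi t / t - phi t).
    by rewrite subr_ge0 !mul1r [phi t + _]addrC subrK => /(_ ph).
  apply: (@norm_upper _ p _ 1 phi hp (ltW s0) nphi p0) => // u g u0 g0.
  by have := pointwise_indicator hp sg u0 g0; rewrite !mul1r.
- move=> C Cp H; have [a a0] := near0_power_sharp hp Cp.
  by apply; apply: H; exact: near0_power_vanishing.
- move=> C Cp H; apply: (indicator_upper_sharp hp Cp); apply: H.
  exact: near0_power_vanishing.
- move=> phi /nonincreasing_vanishing_facts[nphi p0 van].
  (* With [sigma = -1] both pointwise bounds are reversed and exchange roles: the weight 1 now
     serves the lower norm inequality and [lam p] the upper one, where [lam p >= 0] suffices. *)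
  have sg : 0 <= -1 * (2 - p) by rewrite mulN1r opprB subr_ge0.
  split.
    apply: (@norm_lower _ p _ 1 phi hp (ltW s0) nphi p0); first by rewrite ler01 lexx.
    move=> t t0 ph.
    have := pointwise_indicator hp sg (p0 t t0) (_ : 0 <= cumul phi t / t - phi t).
    by rewrite subr_ge0 !mulN1r lerN2 !mul1r [phi t + _]addrC subrK => /(_ ph).
  rewrite -[X in (X%:E * _)%E]root.
  apply: (@norm_upper _ p _ (lam p) phi hp (ltW K0) nphi p0) => //.
    exact: lam_ge0.
  move=> u g u0 g0.
  by have := pointwise_power hp sg u0 g0; rewrite !mulN1r lerN2.
- move=> C Cp H; apply: (indicator_lower_sharp hp Cp); apply: H.
  exact: near0_power_vanishing.
- move=> C Cp H; have [a a0] := infty_power_sharp hp Cp.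
  by apply; apply: H; apply: infty_power_vanishing => //; exact: ltW.
Qed.
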